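(* There is no separable Banach algebra $B$ such that for every separable Banach algebra $A$ there exists a bounded injective homomorphism $A\to B$. The same holds in the commutative and contractive settings: there is no separable Banach algebra $B$ such that for every separable Banach algebra $A$ there exists a contractive injective homomorphism $A\to B$; there is no separable commutative Banach algebra $B$ such that for every separable commutative Banach algebra $A$ there exists a bounded injective homomorphism $A\to B$; and there is no separable commutative Banach algebra $B$ such that for every separable commutative Banach algebra $A$ there exists a contractive injective homomorphism $A\to B$.
   Context: All Banach algebras are over $\mathbb{C}$: a Banach algebra is an associative $\mathbb{C}$-algebra that is a Banach space with a submultiplicative norm. Banach algebras are not assumed unital. A homomorphism is a $\mathbb{C}$-linear multiplicative map; homomorphisms are not assumed unital. The injective homomorphisms here are not required to have closed range. Contractive means operator norm at most $1$; bounded means finite operator norm. Separable means separable as a metric space in the norm. *)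

(* Defs.v *)
From mathcomp Require Import all_boot all_order all_algebra complex.
From mathcomp Require Import all_classical all_reals all_analysis.

Set Implicit Arguments.
Unset Strict Implicit.
Unset Printing Implicit Defensive.

Import Order.TTheory GRing.Theory Num.Theory.
Import numFieldNormedType.Exports.

Local Open Scope classical_set_scope.
Local Open Scope complex_scope.
Local Open Scope ring_scope.

(* The norm of a normed module over R[i] takes its values in R[i]; these values
   are nonnegative, hence real, and [<=] on R[i] compares only numbers with the
   same imaginary part, so the inequality [bmul_norm] is the usual one.
   The ring structures of MathComp all have a unit, hence the explicit product. *)
Record banachAlgebra (R : realType) := BanachAlgebra {
  bspace :> completeNormedModType R[i];
  bmul : bspace -> bspace -> bspace;
  bmulA : associative bmul;
  bmul_linearl : forall y, linear (fun x => bmul x y);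
  bmul_linearr : forall x, linear (bmul x);
  bmul_norm : forall x y, `|bmul x y| <= `|x| * `|y|
}.

Definition separable_space (T : topologicalType) : Prop :=
  exists D : set T, countable D /\ dense D.

Section Homomorphisms.
Context {R : realType}.

Definition commutative_algebra (A : banachAlgebra R) : Prop :=
  commutative (@bmul R A).

Definition algebra_hom (A B : banachAlgebra R) (f : A -> B) : Prop :=
  linear f /\ {morph f : x y / bmul x y >-> bmul x y}.

(* [complex.Re] only casts the real number [`|f x|] from R[i] to R. *)
Definition opnorm (V W : normedModType R[i]) (f : V -> W) : \bar R :=
  ereal_sup [set (complex.Re `|f x|)%:E | x in [set x : V | `|x| <= 1]].

Definition bounded_op (V W : normedModType R[i]) (f : V -> W) : Prop :=
  (opnorm f < +oo)%E.

Definition contractive_op (V W : normedModType R[i]) (f : V -> W) : Prop :=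
  (opnorm f <= 1)%E.

Definition bounded_embeds (A B : banachAlgebra R) : Prop :=
  exists f : A -> B, [/\ algebra_hom f, injective f & bounded_op f].

Definition contractive_embeds (A B : banachAlgebra R) : Prop :=
  exists f : A -> B, [/\ algebra_hom f, injective f & contractive_op f].

End Homomorphisms.

(* Main.v *)
Require Import Defs.
From Stdlib Require Import Btauto.
From HB Require Import structures.
From mathcomp Require Import all_boot all_order all_algebra complex.
From mathcomp Require Import all_classical all_reals all_analysis.
From mathcomp Require Import zify ring lra.

Set Implicit Arguments.
Unset Strict Implicit.
Unset Printing Implicit Defensive.

Import Order.TTheory GRing.Theory Num.Theory.
Import numFieldNormedType.Exports.

Local Open Scope classical_set_scope.
Local Open Scope complex_scope.
Local Open Scope ring_scope.

(** There is a family of separable commutative Banach algebras [davie s], indexed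
    by the binary sequences [s], that cannot all be mapped into one separable
    algebra [B] by bounded injective homomorphisms. Contractive homomorphisms are
    bounded and the [davie s] are commutative, so this settles all four claims.

    The algebra [davie s] is X + X' + C.z, where z annihilates everything and
    x * x' = <x, x'> z / 2 for x in X and x' in X'. The space X is a space of
    bounded functions, modelled on the spaces of Enflo and Davie that lack the
    approximation property: it is spanned by vectors e_i with i in a sequence of
    finite sets F_0, F_1, ... (here F_k consists of the words of length k), and X'
    is spanned by the coordinate functionals e'_i. The point is that the averages
    beta_k of the tensors e_i (x) e'_i over F_k are close to each other: there are
    small vectors u_g and evaluations v_g of norm at most 1, both combinations of
    levels k and k+1 only, with
      beta_k - beta_(k+1) = average over g of u_g (x) v_g,  |u_g| <= 2 eta_k,
    and the numbers eta_k are summable ([rn_davie_small], [eval_decomposition]).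
    The coefficients of u_g and v_g are the entries of explicit sign matrices:
    orthogonality of their columns gives the formula for the average, and
    incoherence of their rows gives the bound on u_g. The columns that serve level
    k+1 are taken from one of two mutually orthogonal sets, chosen by the bit s(k).

    Let f and f' be homomorphisms from [davie s] and [davie s'] to [B], bounded by
    M, and apply f(x) f'(x') to the tensors. If s and s' agree at k, the formula
    above holds across the two algebras; if they differ at k, the average is
    beta_k itself ([row_average]). Hence if s and s' first differ at some n >= k,
    telescoping from k to n bounds the value on beta_k by a tail of the sum of
    2 M^2 eta_l ([rn_trace]). On the other hand, if f and f' nearly agree on the
    finitely many vectors e_i of level k, this value is nearly f'(z) / 2
    ([rn_socle_image]), which is not 0 when f' is injective.

    Given one injective homomorphism for each s, let k be a level for which the
    tail is small compared with M and |f(z)|. The bounds, the first k bits of s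
    and approximations of the images of the e_i of level k by points of a
    countable dense set of [B] form a countable datum, so two different sequences
    share it ([countable_code_collision]), which is a contradiction. *)

(** * Real-valued norms *)
Section RealNorm.
Context {R : realType} {V : normedZmodType R[i]}.
Implicit Types (x y : V).

(** The norms of modules over [R[i]] take values in [R[i]]; all estimates are done
    on their real parts, where the order is total. *)
Definition rn x : R := complex.Re `|x|.

Lemma rnE x : `|x| = (rn x)%:C.
Proof. by rewrite /rn RRe_real ?normr_real. Qed.

Lemma rn_ge0 x : 0 <= rn x.
Proof. by rewrite -ler0c -rnE normr_ge0. Qed.

Lemma rnD x y : rn (x + y) <= rn x + rn y.
Proof. by rewrite -lecR rmorphD /= -!rnE ler_normD. Qed.

Lemma rnN x : rn (- x) = rn x.
Proof. by rewrite /rn normrN. Qed.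

Lemma rnB x y : rn (x - y) <= rn x + rn y.
Proof. by rewrite -(rnN y) rnD. Qed.

Lemma rnC x y : rn (x - y) = rn (y - x).
Proof. by rewrite /rn distrC. Qed.

Lemma rn0 : rn 0 = 0.
Proof. by rewrite /rn normr0. Qed.

Lemma rn_eq0 x : rn x = 0 -> x = 0.
Proof. by move=> x0; apply/eqP; rewrite -normr_eq0 rnE x0. Qed.

Lemma rn_sum (I : Type) (r : seq I) (P : pred I) (F : I -> V) :
  rn (\sum_(i <- r | P i) F i) <= \sum_(i <- r | P i) rn (F i).
Proof.
elim/big_rec2: _ => [|i y x _ xy]; first by rewrite rn0.
by rewrite (le_trans (rnD _ _))// lerD2l.
Qed.

Lemma rn_triangle z x y : rn (x - y) <= rn (x - z) + rn (z - y).
Proof. by rewrite -[x - y](subrKA z) rnD. Qed.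

End RealNorm.

Section RealNormScalars.
Context {R : realType}.
Local Notation C := (R[i]).
Implicit Types (a b : C).

Lemma rnM a b : rn (a * b) = rn a * rn b.
Proof. by apply: (@complexI R); rewrite rmorphM /= -!rnE normrM. Qed.

Lemma rnZ (V : normedModType C) a (x : V) : rn (a *: x) = rn a * rn x.
Proof. by apply: (@complexI R); rewrite rmorphM /= -!rnE normrZ. Qed.

Lemma rnV a : rn a^-1 = (rn a)^-1.
Proof. by apply: (@complexI R); rewrite fmorphV /= -!rnE normfV. Qed.

Lemma rn_real (r : R) : rn (r%:C : C) = `|r|.
Proof. by rewrite /rn normc_def /= expr0n /= addr0 sqrtr_sqr. Qed.

Lemma rn_nat n : rn (n%:R : C) = n%:R.
Proof. by rewrite -(rmorph_nat (real_complex R)) rn_real normr_nat. Qed.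

Lemma rn1 : rn (1 : C) = 1.
Proof. exact: rn_nat 1%N. Qed.

Lemma rn_le_parts a : rn a <= `|complex.Re a| + `|complex.Im a|.
Proof.
rewrite {1}[a]complexE (le_trans (rnD _ _))// rnM !rn_real.
suff -> : rn ('i%C : C) = 1 by rewrite mul1r.
by rewrite /rn normc_def /= expr0n expr1n add0r sqrtr1.
Qed.

Lemma rn_ge_Re a : `|complex.Re a| <= rn a.
Proof. by rewrite -lecR -rnE normc_ge_Re. Qed.

Lemma rn_ge_Im a : `|complex.Im a| <= rn a.
Proof.
rewrite -normrN -ReiNIm (le_trans (rn_ge_Re _))// rnM.
suff -> : rn ('i%C : C) = 1 by rewrite mulr1.
by rewrite /rn normc_def /= expr0n expr1n add0r sqrtr1.
Qed.

Lemma nested_intervals (I : Type) (r d : I -> R) (i0 : I) :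
  (forall i j, r i - d i <= r j + d j) ->
  exists y, forall i, r i - d i <= y <= r i + d i.
Proof.
move=> rd; pose S := [set r i - d i | i in setT].
have S0 : S !=set0 by exists (r i0 - d i0), i0.
have ubS j : ubound S (r j + d j) by move=> _ [i _ <-].
exists (sup S) => i; apply/andP; split.
  apply: ub_le_sup; first by exists (r i0 + d i0).
  by exists i.
exact: ge_sup.
Qed.

(** Completeness of the complex plane: a compatible family of discs meets, after
    doubling the radii because real and imaginary parts are treated apart. *)
Lemma nested_discs (I : Type) (c : I -> C) (d : I -> R) (i0 : I) :
  (forall i j, rn (c i - c j) <= d i + d j) ->
  exists y, forall i, rn (c i - y) <= 2 * d i.
Proof.
move=> cd.
have [x xP] : exists y, forall i,
    complex.Re (c i) - d i <= y <= complex.Re (c i) + d i.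
  apply: nested_intervals => // i j; have := cd i j.
  have := rn_ge_Re (c i - c j); rewrite raddfB /= ler_norml => /andP[_].
  lra.
have [y yP] : exists y, forall i,
    complex.Im (c i) - d i <= y <= complex.Im (c i) + d i.
  apply: nested_intervals => // i j; have := cd i j.
  have := rn_ge_Im (c i - c j); rewrite raddfB /= ler_norml => /andP[_].
  lra.
exists (x +i* y)%C => i; rewrite (le_trans (rn_le_parts _))//.
have := xP i; have := yP i; case: (c i) => a b /= /andP[? ?] /andP[? ?].
have : `|a - x| <= d i by rewrite ler_norml; apply/andP; split; lra.
have : `|b - y| <= d i by rewrite ler_norml; apply/andP; split; lra.
lra.
Qed.

End RealNormScalars.

(** * Closed spans of families of functions in the supremum norm *)
Section SupNorm.
Context {R : realType} {T : Type}.
Local Notation C := (R[i]).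
Implicit Types (f g : T -> C^o).

Definition bounded_by (M : R) f := forall t, rn (f t : C) <= M.

(** The value 0 is included so that an empty index type gives the norm 0. *)
Definition supnorm f : R :=
  sup [set r | r = 0 \/ exists t, r = rn (f t : C)].

Lemma supnorm_le (M : R) f : 0 <= M -> bounded_by M f -> supnorm f <= M.
Proof.
move=> M0 fM; apply: ge_sup; first by exists 0; left.
by move=> _ [->|[t ->]].
Qed.

Lemma supnorm_ub f : (exists M, bounded_by M f) ->
  forall r, (r = 0 \/ exists t, r = rn (f t : C)) -> r <= supnorm f.
Proof.
move=> [M fM] r rP; apply: ub_le_sup => //; exists (Num.max 0 M).
by move=> _ [->|[t ->]]; rewrite le_max ?lexx// fM orbT.
Qed.

Lemma supnorm_ge f t : (exists M, bounded_by M f) -> rn (f t : C) <= supnorm f.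
Proof. by move=> bf; apply: supnorm_ub => //; right; exists t. Qed.

Lemma supnorm_ge0 f : (exists M, bounded_by M f) -> 0 <= supnorm f.
Proof. by move=> bf; apply: supnorm_ub => //; left. Qed.

End SupNorm.

Section ClosedSpan.
Context {R : realType} {T : Type} {K : countType}.
Local Notation C := (R[i]).
Variable g : K -> T -> C^o.
Implicit Types (f : T -> C^o) (l : seq (C * K)).

Definition lincomb l : T -> C^o := fun t => \sum_(p <- l) p.1 * g p.2 t.

Lemma lincomb_cat l l' t : lincomb (l ++ l') t = lincomb l t + lincomb l' t.
Proof. by rewrite /lincomb big_cat. Qed.

Lemma lincomb_scale a l t :
  lincomb [seq (a * p.1, p.2) | p <- l] t = a * lincomb l t.
Proof.
by rewrite /lincomb big_map mulr_sumr; apply: eq_bigr => p _; rewrite mulrA.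
Qed.

(** The members of [g] need not be bounded here; boundedness is required of the
    limit only. *)
Definition closed_span f := (exists M, bounded_by M f) /\
  forall e : R, 0 < e -> exists l, bounded_by e (fun t => f t - lincomb l t).

Definition in_closed_span : {pred T -> C^o} := [pred f | `[< closed_span f >]].

Lemma closed_spanP f : reflect (closed_span f) (f \in in_closed_span).
Proof. exact: asboolP. Qed.

Lemma closed_span_submod : submod_closed in_closed_span.
Proof.
split=> [|a f f' /closed_spanP[[M fM] fl] /closed_spanP[[M' fM'] fl']].
  apply/closed_spanP; split; first by exists 0 => t; rewrite rn0.
  move=> e e0; exists [::] => t.
  by rewrite /lincomb big_nil subr0 rn0 ltW.
apply/closed_spanP; split.
  exists (rn a * M + M') => t; rewrite (le_trans (rnD _ _))//.
  by rewrite lerD// rnM ler_wpM2l ?rn_ge0.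
move=> e e0; have a1 : 0 < rn a + 1 by rewrite ltr_wpDl ?rn_ge0.
have [|l lP] := fl (e / 2 / (rn a + 1)); first by rewrite !divr_gt0.
have [|l' lP'] := fl' (e / 2); first by rewrite divr_gt0.
exists ([seq (a * p.1, p.2) | p <- l] ++ l') => t.
rewrite lincomb_cat lincomb_scale.
have -> : ((a *: f + f') t : C) - (a * lincomb l t + lincomb l' t) =
    a * (f t - lincomb l t) + (f' t - lincomb l' t).
  by rewrite mulrBr addrACA -opprD.
rewrite (le_trans (rnD _ _))// [leRHS](splitr e) lerD// rnM.
rewrite (le_trans (ler_wpM2l (rn_ge0 _) (lP t)))//.
rewrite mulrCA ler_piMr ?divr_ge0 ?ltW//.
by rewrite ltr_pdivrMr// mul1r ltrDl.
Qed.

(** The closed linear span of [g] among the bounded functions, as a type of its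
    own; a Banach space in the supremum norm. *)
Record clspan := ClSpan {
  csval :> T -> C^o; csvalP : csval \in in_closed_span }.
HB.instance Definition _ := [isSub for csval].
HB.instance Definition _ := [Choice of clspan by <:].
HB.instance Definition _ := GRing.isSubmodClosed.Build C (T -> C^o)
  in_closed_span closed_span_submod.
HB.instance Definition _ := [SubChoice_isSubLmodule of clspan by <:].

End ClosedSpan.

Section ClosedSpanBanach.
Context {R : realType} {T : Type} {K : countType}.
Local Notation C := (R[i]).
Variable g : K -> T -> C^o.
Local Notation A := (clspan g).
Implicit Types (x y : A) (f : T -> C^o).

Lemma csvalD x y t : csval (x + y) t = csval x t + csval y t.
Proof. by rewrite (_ : csval _ = csval x + csval y)// -raddfD. Qed.

Lemma csvalZ a x t : csval (a *: x) t = a * csval x t :> C.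
Proof. by rewrite (_ : csval _ = a *: csval x)// -linearZ. Qed.

Lemma csvalB x y t : csval (x - y) t = csval x t - csval y t.
Proof. by rewrite csvalD -scaleN1r csvalZ mulN1r. Qed.

Lemma csval0 t : csval (0 : A) t = 0.
Proof. by rewrite -[0 in LHS](scale0r (0 : A)) csvalZ mul0r. Qed.

Lemma csval_sum (I : Type) (r : seq I) (P : pred I) (F : I -> A) t :
  csval (\sum_(i <- r | P i) F i) t = \sum_(i <- r | P i) csval (F i) t.
Proof.
elim/big_rec2: _ => [|i y x _ <-]; first exact: csval0.
by rewrite csvalD.
Qed.

Lemma csval_inj x y : csval x = csval y -> x = y.
Proof. exact: val_inj. Qed.

Lemma cs_bounded x : exists M, bounded_by M (csval x).
Proof. by have /closed_spanP[] := csvalP x. Qed.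

Lemma cs_supnorm_ge0 x : 0 <= supnorm (csval x).
Proof. exact/supnorm_ge0/cs_bounded. Qed.

Lemma cs_le_supnorm x t : rn (csval x t : C) <= supnorm (csval x).
Proof. exact/supnorm_ge/cs_bounded. Qed.

Definition csnorm x : C := (supnorm (csval x))%:C.

Lemma csnormD x y : csnorm (x + y) <= csnorm x + csnorm y.
Proof.
rewrite /csnorm -rmorphD lecR; apply: supnorm_le.
  by apply: addr_ge0; apply: cs_supnorm_ge0.
by move=> t; rewrite csvalD (le_trans (rnD _ _))// lerD// cs_le_supnorm.
Qed.

Lemma csnormZ (a : C) x : csnorm (a *: x) = `|a| * csnorm x.
Proof.
rewrite rnE /csnorm -rmorphM; congr (_%:C).
have leZ (b : C) (z : A) : supnorm (csval (b *: z)) <= rn b * supnorm (csval z).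
  apply: supnorm_le; first by apply: mulr_ge0; [exact: rn_ge0|exact: cs_supnorm_ge0].
  by move=> t; rewrite csvalZ rnM ler_wpM2l ?rn_ge0// cs_le_supnorm.
apply/eqP; rewrite eq_le leZ andTb.
have [->|a0] := eqVneq a 0.
  by rewrite rn0 mul0r; exact: cs_supnorm_ge0.
have ra0 : 0 < rn a by rewrite lt_neqAle rn_ge0 eq_sym andbT; apply: contra a0 => /eqP/rn_eq0->.
rewrite -ler_pdivlMl// -rnV.
by rewrite (le_trans _ (leZ _ _))// scalerA mulVf// scale1r.
Qed.

Lemma csnorm_eq0 x : csnorm x = 0 -> x = 0.
Proof.
move=> [x0]; apply: csval_inj; apply/funext => t; rewrite csval0.
apply: (@rn_eq0 _ C); apply/eqP; rewrite eq_le rn_ge0 andbT -x0.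
exact: cs_le_supnorm.
Qed.

HB.instance Definition _ := Lmodule_isNormed.Build C A csnormD csnormZ csnorm_eq0.

Lemma cs_le_rn x t : rn (csval x t : C) <= rn x.
Proof. exact: cs_le_supnorm. Qed.

Lemma cs_rn_le x M : 0 <= M -> bounded_by M (csval x) -> rn x <= M.
Proof. exact: supnorm_le. Qed.

Lemma cs_approx x (e : R) : 0 < e -> exists l, bounded_by e (fun t => csval x t - lincomb g l t).
Proof. by have /closed_spanP[_] := csvalP x; exact. Qed.

Lemma closed_span_limit f :
  (forall e : R, 0 < e -> exists x, bounded_by e (fun t => csval x t - f t)) ->
  closed_span g f.
Proof.
move=> fx; split.
  have [x xf] := fx 1 ltr01; have [M xM] := cs_bounded x.
  exists (M + 1) => t; rewrite -[f t](subKr (csval x t)).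
  by rewrite (le_trans (rnB _ _))// lerD.
move=> e e0; have e20 : 0 < e / 2 by rewrite divr_gt0.
have [x xf] := fx _ e20; have [l xl] := cs_approx x e20.
exists l => t; rewrite (le_trans (rn_triangle (csval x t : C) _ _))//.
by rewrite [leRHS](splitr e) lerD// rnC.
Qed.

(** A Cauchy filter has pointwise limits by [nested_discs]; they are uniform, so
    that the limit function is still approximated by combinations of [g]. *)
Lemma clspan_complete (F : set_system A) : ProperFilter F -> cauchy F -> cvg F.
Proof.
move=> FF Fc0; have Fc : cauchy_ex F by apply/cauchyP.
have pos_lt (e : {posnum R}) : (0 : C) < (e%:num)%:C by rewrite ltcR.
have /choice[x xF] (e : {posnum R}) : exists x, F [set y | rn (x - y) < e%:num].
  have [x xe] := Fc _ (pos_lt e); exists x; apply: filterS xe => y.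
  by rewrite -ball_normE /= rnE ltcR.
have xx (e e' : {posnum R}) : rn (x e - x e') <= e%:num + e'%:num.
  have [y [/= /ltW xy /ltW yx]] := filter_ex (filterI (xF e) (xF e')).
  by rewrite (le_trans (rn_triangle y _ _))// lerD// rnC.
have /choice[f fP] t : exists y : C, forall e : {posnum R},
    rn (csval (x e) t - y : C) <= 2 * e%:num.
  apply: (@nested_discs _ _ (fun e => csval (x e) t : C) (fun e : {posnum R} => e%:num) 1%:pos) => e e'.
  by rewrite -csvalB (le_trans (cs_le_rn _ _)).
have fS : (f : T -> C^o) \in in_closed_span g.
  apply/closed_spanP; apply: closed_span_limit => e e0.
  have e20 : 0 < e / 2 by rewrite divr_gt0.
  exists (x (PosNum e20)) => t; rewrite (le_trans (fP _ _))//=.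
  by rewrite mulrCA divff ?mulr1.
apply/cvg_ex; exists (ClSpan fS); apply/cvgrPdist_le => /= e egt0.
have e0 : 0 < complex.Re e by move: egt0; rewrite ltcE => /andP[_].
have e40 : 0 < complex.Re e / 4 by rewrite divr_gt0.
have -> : e = (complex.Re e)%:C by rewrite RRe_real// gtr0_real.
have := xF (PosNum e40); apply: filterS => y /= xy; rewrite rnE lecR.
rewrite (le_trans (rn_triangle (x (PosNum e40)) _ _))//.
have : rn (ClSpan fS - x (PosNum e40)) <= 2 * (complex.Re e / 4).
  by apply: cs_rn_le => [|t]; [rewrite mulr_ge0 ?ltW | rewrite csvalB rnC; apply: fP].
lra.
Qed.

HB.instance Definition _ := Uniform_isComplete.Build A clspan_complete.

End ClosedSpanBanach.

Section ClosedSpanSeparable.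
Context {R : realType} {T : Type} {K : countType}.
Local Notation C := (R[i]).
Variable g : K -> T -> C^o.
Hypothesis g_bounded : forall k, exists M, bounded_by M (g k).
Local Notation A := (clspan g).

Lemma lincomb_bounded l : exists M, bounded_by M (lincomb g l).
Proof.
elim: l => [|[a k] l [M lM]].
  by exists 0 => t; rewrite /lincomb big_nil rn0.
have [N kN] := g_bounded k; exists (rn a * N + M) => t.
rewrite /lincomb big_cons (le_trans (rnD _ _))// lerD//; last exact: lM.
by rewrite rnM ler_wpM2l ?rn_ge0.
Qed.

Lemma lincomb_closed_span l : lincomb g l \in in_closed_span g.
Proof.
apply/closed_spanP; split; first exact: lincomb_bounded.
by move=> e e0; exists l => t; rewrite subrr rn0 ltW.
Qed.

Definition comb l : A := ClSpan (lincomb_closed_span l).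

Definition gen k : A := comb [:: (1, k)].

Lemma genE k t : csval (gen k) t = g k t.
Proof. by rewrite /= /lincomb big_seq1 mul1r. Qed.

Definition ratc (q : rat * rat) : C := (ratr q.1 +i* ratr q.2)%C.

Lemma ratc_dense (a : C) (e : R) : 0 < e -> exists q, rn (a - ratc q) <= e.
Proof.
move=> e0; case: a => u v; have e20 : 0 < e / 2 by rewrite divr_gt0.
have rat_approx (r : R) : exists q : rat, `|r - ratr q| <= e / 2.
  have [|q] := @rat_in_itvoo _ r (r + e / 2); first by rewrite ltrDl.
  rewrite in_itv /= => /andP[q1 q2]; exists q.
  by rewrite ler_norml; apply/andP; split; lra.
have [q uq] := rat_approx u; have [p vp] := rat_approx v.
exists (q, p); rewrite (le_trans (rn_le_parts _))//= (le_trans (lerD uq vp))//.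
lra.
Qed.

Lemma lincomb_rat l (e : R) : 0 < e -> exists l' : seq ((rat * rat) * K),
  bounded_by e (fun t => lincomb g l t - lincomb g [seq (ratc p.1, p.2) | p <- l'] t).
Proof.
elim: l e => [|[a k] l IH] e e0.
  by exists [::] => t; rewrite /lincomb !big_nil subrr rn0 ltW.
have e20 : 0 < e / 2 by rewrite divr_gt0.
have [N kN] := g_bounded k; have [l' lP] := IH _ e20.
have N1 : 0 < `|N| + 1 by rewrite ltr_wpDl.
have [|q qP] := @ratc_dense a (e / 2 / (`|N| + 1)); first by rewrite divr_gt0.
exists ((q, k) :: l') => t; rewrite /lincomb big_map !big_cons /= opprD addrACA.
rewrite [leRHS](splitr e) (le_trans (rnD _ _))// lerD//; last first.
  by have := lP t; rewrite /lincomb big_map.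
rewrite -mulrBl rnM -[leRHS](mulfVK (lt0r_neq0 N1)).
rewrite ler_pM ?rn_ge0// (le_trans (kN t))// (le_trans (ler_norm _))//.
by rewrite lerDl.
Qed.

(** Combinations with rational complex coefficients are dense. *)
Lemma clspan_separable : separable_space A.
Proof.
pose h (l : seq ((rat * rat) * K)) := comb [seq (ratc p.1, p.2) | p <- l].
exists (range h); split.
  exact: (sub_countable (card_image_le h setT) (countableP _)).
move=> O [x Ox] Oo; have : nbhs x O by apply: open_nbhs_nbhs.
move=> /nbhs_ballP[e /= e0 xO].
have r0 : 0 < complex.Re e by move: e0; rewrite ltcE => /andP[_].
have eE : e = (complex.Re e)%:C by rewrite RRe_real// gtr0_real.
have r30 : 0 < complex.Re e / 3 by rewrite divr_gt0.
have [l xl] := cs_approx x r30; have [l' ll'] := lincomb_rat l r30.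
exists (h l'); split; last by exists l'.
apply: xO; rewrite -ball_normE /= rnE eE ltcR.
have : rn (x - h l') <= complex.Re e / 3 + complex.Re e / 3.
  apply: cs_rn_le => [|t]; first by rewrite addr_ge0 ?ltW.
  rewrite csvalB (le_trans (rn_triangle (lincomb g l t) _ _))// lerD//.
lra.
Qed.

End ClosedSpanSeparable.

(** * The algebra of a family of vectors and of evaluation functionals *)
Local Arguments csval : simpl never.

Section PairingAlgebra.
Context {R : realType} {K I : countType}.
Local Notation C := (R[i]).
Variable e : K -> I -> C^o.
Hypothesis e_le1 : forall k, bounded_by 1 (e k).

Local Notation X := (clspan e).

Let e_bounded k : exists M, bounded_by M (e k).
Proof. by exists 1. Qed.

Definition ball1 := {x : X | rn x <= 1}.

(** The elements of the algebra are realized as functions on this set: the points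
    of [I] see the component in [X] as a function on [I], the unit ball of [X] sees
    the component in the dual as a functional, and [None] sees the coefficient of
    the socle element. The supremum norm is thus the maximum of the norm of [X],
    the dual norm and the absolute value. *)
Definition point := option (I + ball1).

Definition generator (k : option (K + I)) (t : point) : C^o :=
  match k, t with
  | None, None => 1
  | Some (inl k), Some (inl i) => e k i
  | Some (inr i), Some (inr x) => csval (val x) i
  | _, _ => 0
  end.

Lemma generator_le1 k : bounded_by 1 (generator k).
Proof.
case: k => [[k|i]|] [[j|x]|] /=; rewrite ?rn0 ?rn1 ?ler01//.
  exact: e_le1.
by rewrite (le_trans (cs_le_rn _ _)) ?(valP x).
Qed.

Let generator_bounded k : exists M, bounded_by M (generator k).
Proof. by exists 1; apply: generator_le1. Qed.

Local Notation A := (clspan generator).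
Implicit Types (x y : X) (F G H : A).

(** [vec k] is the spanning vector [e k], [ev i] is the evaluation functional at
    [i], and [bvec k] is [e k] seen in [X]. *)
Definition vec k : A := gen generator_bounded (Some (inl k)).
Definition ev i : A := gen generator_bounded (Some (inr i)).
Definition socle : A := gen generator_bounded None.
Definition bvec k : X := gen e_bounded k.

Lemma vecE k t : csval (vec k) t = generator (Some (inl k)) t.
Proof. exact: genE. Qed.

Lemma evE i t : csval (ev i) t = generator (Some (inr i)) t.
Proof. exact: genE. Qed.

Lemma socleE t : csval socle t = generator None t.
Proof. exact: genE. Qed.

Lemma bvecE k i : csval (bvec k) i = e k i.
Proof. exact: genE. Qed.

Lemma rn_ev i : rn (ev i) <= 1.
Proof. by apply: cs_rn_le => // t; rewrite evE generator_le1. Qed.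

Lemma rn_socle : rn socle <= 1.
Proof. by apply: cs_rn_le => // t; rewrite socleE generator_le1. Qed.

(** The component in [X] of an element of the algebra lies in the closed span of
    [e], since the other generators vanish on [I]. *)
Lemma restr_closed_span F :
  (fun i => csval F (Some (inl i))) \in in_closed_span e.
Proof.
apply/closed_spanP; split.
  by have [M FM] := cs_bounded F; exists M => i; apply: FM.
move=> d d0; have [l lP] := cs_approx F d0.
pose f (p : C * option (K + I)) :=
  if p.2 is Some (inl k) then Some (p.1, k) else None.
exists (pmap f l) => i; have := lP (Some (inl i)).
suff -> : lincomb generator l (Some (inl i)) = lincomb e (pmap f l) i by [].
rewrite /lincomb {lP}; elim: l => [|[a [[k|j]|]] l IH] //=.
- by rewrite !big_nil.
- by rewrite !big_cons IH.
- by rewrite big_cons IH /= mulr0 add0r.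
- by rewrite big_cons IH /= mulr0 add0r.
Qed.

Definition restr F : X := ClSpan (restr_closed_span F).

Lemma restrE F i : csval (restr F) i = csval F (Some (inl i)).
Proof. by []. Qed.

Lemma restr_linear : linear restr.
Proof.
move=> a F G; apply: csval_inj; apply/funext => i.
by rewrite csvalD csvalZ !restrE csvalD csvalZ.
Qed.

Lemma rn_restr F : rn (restr F) <= rn F.
Proof. by apply: cs_rn_le => [|i]; [exact: rn_ge0 | exact: (cs_le_rn F)]. Qed.

Lemma restr_vec k : restr (vec k) = bvec k.
Proof. by apply: csval_inj; apply/funext => i; rewrite bvecE restrE vecE. Qed.

Lemma restr_ev i : restr (ev i) = 0.
Proof. by apply: csval_inj; apply/funext => j; rewrite csval0 restrE evE. Qed.

Lemma restr_socle : restr socle = 0.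
Proof. by apply: csval_inj; apply/funext => j; rewrite csval0 restrE socleE. Qed.

(** Every element acts on the unit ball of [X] by evaluation, and on all of [X]
    by homogeneity. *)
Definition ball_eval G x : C :=
  if pselect (rn x <= 1) is left x1 then csval G (Some (inr (exist _ x x1)))
  else 0.

Definition pairing x G : C := (rn x)%:C * ball_eval G ((rn x)^-1%:C *: x).

Lemma rn_normalize x : rn ((rn x)^-1%:C *: x) <= 1.
Proof.
rewrite rnZ rn_real ger0_norm ?invr_ge0 ?rn_ge0//.
by have [->|x0] := eqVneq (rn x) 0; rewrite ?mulr0// mulVf.
Qed.

Lemma ball_evalE G x (x1 : rn x <= 1) :
  ball_eval G x = csval G (Some (inr (exist _ x x1))).
Proof.
rewrite /ball_eval; case: pselect => // x1'.
by rewrite (Prop_irrelevance x1 x1').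
Qed.

Lemma pairing_le x G : rn (pairing x G) <= rn x * rn G.
Proof.
rewrite /pairing rnM rn_real ger0_norm ?rn_ge0// ler_wpM2l ?rn_ge0//.
by rewrite (ball_evalE _ (rn_normalize x)) cs_le_rn.
Qed.

Lemma pairing_linearr x : linear (pairing x : A -> C^o).
Proof.
move=> a F G; rewrite /pairing !(ball_evalE _ (rn_normalize x)).
by rewrite csvalD csvalZ mulrDr /GRing.scale/= mulrCA.
Qed.

(* The functional on [X] given by a finite combination of generators. *)
Let sample (l : seq (C * option (K + I))) x : C :=
  \sum_(p <- l) p.1 * (if p.2 is Some (inr i) then csval x i else 0).

Let sample_linear l a x y : sample l (a *: x + y) = a * sample l x + sample l y.
Proof.
rewrite /sample mulr_sumr -big_split /=; apply: eq_bigr => -[b k] _ /=.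
case: k => [[k|i]|] /=; rewrite ?mulr0 ?addr0 //.
by rewrite csvalD csvalZ mulrDr mulrCA.
Qed.

Let pairing_approx G d : 0 < d ->
  exists l, (forall x, rn (pairing x G - sample l x) <= rn x * d) /\
    forall x : ball1, rn (csval G (Some (inr x)) - sample l (val x) : C) <= d.
Proof.
have sampleE l (x : ball1) : lincomb generator l (Some (inr x)) = sample l (val x).
  by apply: eq_bigr => -[a [[k|i]|]] _.
move=> d0; have [l lP] := cs_approx G d0; exists l; split=> x; last first.
  by have := lP (Some (inr x)); rewrite sampleE.
have [x0|x0] := eqVneq (rn x) 0.
  rewrite /pairing x0 mul0r mul0r (rn_eq0 x0) sub0r rnN.
  have := sample_linear l (-1) 0 0; rewrite scaler0 addr0 mulN1r addNr => ->.
  by rewrite rn0.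
set u := (rn x)^-1%:C *: x; have u1 : rn u <= 1 := rn_normalize x.
have xE : x = (rn x)%:C *: u by rewrite scalerA -rmorphM divff// scale1r.
have s0 : sample l 0 = 0.
  by have := sample_linear l (-1) 0 0; rewrite scaler0 addr0 mulN1r addNr.
rewrite {2}xE -[(rn x)%:C *: u]addr0 sample_linear s0 addr0 /pairing -mulrBr.
rewrite rnM rn_real ger0_norm ?rn_ge0// ler_wpM2l ?rn_ge0//.
rewrite (ball_evalE _ u1); have := lP (Some (inr (exist _ u u1))).
by rewrite sampleE.
Qed.

(** The pairing with [G] is a limit of finite combinations of evaluations, uniformly
    on the unit ball, and these are linear. *)
Lemma pairing_linearl G : linear (fun x => pairing x G : C^o).
Proof.
move=> a x y; apply/eqP; rewrite -subr_eq0; apply/eqP/(@rn_eq0 _ C).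
set D := _ - _; pose M := rn (a *: x + y) + (rn a * rn x + rn y).
have M0 : 0 <= M by rewrite !addr_ge0 ?mulr_ge0 ?rn_ge0.
apply/eqP; rewrite eq_le rn_ge0 andbT; apply/ler_addgt0Pl => d d0.
rewrite addr0; have M1 : 0 < M + 1 by rewrite ltr_wpDl.
pose r := d / (M + 1); have [l [lP _]] := @pairing_approx G r (divr_gt0 d0 M1).
have -> : D = (pairing (a *: x + y) G - sample l (a *: x + y))
    - (a * (pairing x G - sample l x) + (pairing y G - sample l y)).
  rewrite /D sample_linear /GRing.scale /=; ring.
rewrite (le_trans (rnB _ _))// (le_trans (lerD (lP _) (rnD _ _)))//.
rewrite rnM (le_trans (lerD (lexx _) (lerD (ler_wpM2l (rn_ge0 _) (lP _)) (lP _))))//.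
have -> : rn (a *: x + y) * r + (rn a * (rn x * r) + rn y * r) = M * r.
  by rewrite /M; ring.
rewrite /r mulrCA ler_piMr ?ltW// ltr_pdivrMr// mul1r.
by rewrite ltrDl.
Qed.

Lemma pairing_ev x i : pairing x (ev i) = csval x i.
Proof.
have [x0|x0] := eqVneq (rn x) 0.
  by rewrite /pairing x0 mul0r (rn_eq0 x0) csval0.
rewrite /pairing (ball_evalE _ (rn_normalize x)) evE /= csvalZ mulrA.
by rewrite -rmorphM divff// mul1r.
Qed.

Lemma pairing_socle x : pairing x socle = 0.
Proof. by rewrite /pairing (ball_evalE _ (rn_normalize x)) socleE mulr0. Qed.

Lemma pairing0l G : pairing 0 G = 0.
Proof. by rewrite /pairing rn0 mul0r. Qed.

(** The factor 1/2 makes the product submultiplicative, as the form is a sum of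
    two pairings. *)
Definition form F G : C := 2^-1 * (pairing (restr F) G + pairing (restr G) F).

Lemma form_linearl G a F F' : form (a *: F + F') G = a * form F G + form F' G.
Proof.
rewrite /form restr_linear pairing_linearl pairing_linearr /GRing.scale /=.
ring.
Qed.

Lemma formC F G : form F G = form G F.
Proof. by rewrite /form addrC. Qed.

Lemma form_socle F : form F socle = 0.
Proof. by rewrite /form pairing_socle restr_socle pairing0l addr0 mulr0. Qed.

Lemma form_le F G : rn (form F G) <= rn F * rn G.
Proof.
rewrite /form rnM rnV rn_nat ler_pdivrMl// mulr2n mulrDl mul1r.
rewrite (le_trans (rnD _ _))// lerD// (le_trans (pairing_le _ _))//.
  by rewrite ler_wpM2r ?rn_ge0 ?rn_restr.
by rewrite mulrC ler_wpM2l ?rn_ge0 ?rn_restr.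
Qed.

Definition pmul F G : A := form F G *: socle.

Lemma pmulC : commutative pmul.
Proof. by move=> F G; rewrite /pmul formC. Qed.

Lemma pmul_socle F : pmul F socle = 0.
Proof. by rewrite /pmul form_socle scale0r. Qed.

Lemma pmul_linearl G : linear (pmul^~ G).
Proof. by move=> a F F'; rewrite /pmul form_linearl scalerDl scalerA. Qed.

Lemma pmul_linearr F : linear (pmul F).
Proof. by move=> a G G'; rewrite !(pmulC F) pmul_linearl. Qed.

Lemma pmul0 F : pmul F 0 = 0.
Proof. by have := pmul_linearr F (-1) 0 0; rewrite scaler0 addr0 scaleN1r addNr. Qed.

Lemma pmulA : associative pmul.
Proof.
have mul0 F G H : pmul F (pmul G H) = 0.
  have := pmul_linearr F (form G H) socle 0.
  by rewrite addr0 pmul_socle scaler0 add0r pmul0.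
by move=> F G H; rewrite mul0 pmulC mul0.
Qed.

Lemma pmul_norm F G : `|pmul F G| <= `|F| * `|G|.
Proof.
rewrite !rnE -rmorphM lecR /pmul rnZ (le_trans _ (form_le F G))//.
by rewrite ler_piMr ?rn_ge0 ?rn_socle.
Qed.

Definition pairing_algebra : banachAlgebra R :=
  @BanachAlgebra R A pmul pmulA pmul_linearl pmul_linearr pmul_norm.

Lemma pairing_ball Y (x : ball1) :
  pairing (val x) Y = csval Y (Some (inr x)).
Proof.
apply/eqP; rewrite -subr_eq0; apply/eqP/(@rn_eq0 _ C).
apply/eqP; rewrite eq_le rn_ge0 andbT; apply/ler_addgt0Pl => d d0.
rewrite addr0; have [l [l1 l2]] := pairing_approx Y (divr_gt0 d0 (ltr0Sn R 1)).
rewrite (le_trans (rn_triangle (sample l (val x)) _ _))// (splitr d) lerD//.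
  by rewrite (le_trans (l1 _))// ler_piMl ?(valP x)// ltW// divr_gt0.
by rewrite rnC l2.
Qed.

Lemma pairing_suml (J : Type) (r : seq J) (F : J -> X) G :
  pairing (\sum_(j <- r) F j) G = \sum_(j <- r) pairing (F j) G.
Proof.
elim: r => [|j r IH]; first by rewrite !big_nil pairing0l.
rewrite !big_cons -IH; have := pairing_linearl G 1 (F j) (\sum_(i <- r) F i).
by rewrite !scale1r.
Qed.

Lemma pairingZl a x G : pairing (a *: x) G = a * pairing x G.
Proof. by rewrite -[a *: x]addr0 pairing_linearl pairing0l addr0. Qed.

Lemma pairingZr a x G : pairing x (a *: G) = a * pairing x G.
Proof.
have z : pairing x 0 = 0.
  have := pairing_linearr x (-1) 0 0.
  by rewrite scaler0 addr0 scaleN1r addNr.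
by rewrite -[a *: G]addr0 pairing_linearr z addr0.
Qed.

Lemma pairingDr x F G : pairing x (F + G) = pairing x F + pairing x G.
Proof. by have := pairing_linearr x 1 F G; rewrite !scale1r. Qed.

Lemma pairingBr x F G : pairing x (F - G) = pairing x F - pairing x G.
Proof. by rewrite pairingDr -scaleN1r pairingZr mulN1r. Qed.

Lemma pairing_sumr (J : Type) (r : seq J) x (F : J -> A) :
  pairing x (\sum_(j <- r) F j) = \sum_(j <- r) pairing x (F j).
Proof.
elim: r => [|j r IH]; last by rewrite !big_cons pairingDr IH.
by rewrite !big_nil -[0 in LHS](scale0r (0 : A)) pairingZr mul0r.
Qed.

(** A functional on [X] is determined by its values on the spanning vectors. *)
Lemma functional_eq0 Y : csval Y None = 0 -> restr Y = 0 ->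
  (forall k, pairing (bvec k) Y = 0) -> Y = 0.
Proof.
move=> Y0 Yl Yk; apply: csval_inj; apply/funext => -[[i|x]|]; rewrite csval0 //.
  by rewrite -restrE Yl csval0.
rewrite -pairing_ball; move: (val x) => {}x.
apply: (@rn_eq0 _ C); apply/eqP; rewrite eq_le rn_ge0 andbT.
apply/ler_addgt0Pl => d d0; rewrite addr0.
have Y1 : 0 < rn Y + 1 by rewrite ltr_wpDl ?rn_ge0.
have [l lP] := cs_approx x (divr_gt0 d0 Y1).
have combE : comb e_bounded l = \sum_(p <- l) p.1 *: bvec p.2.
  apply: csval_inj; apply/funext => i; rewrite csval_sum.
  by apply: eq_bigr => p _; rewrite csvalZ bvecE.
have comb0 : pairing (comb e_bounded l) Y = 0.
  by rewrite combE pairing_suml big1// => p _; rewrite pairingZl Yk mulr0.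
have -> : pairing x Y = pairing (x - comb e_bounded l) Y.
  rewrite -[x - _]addrC -scaleN1r pairing_linearl comb0.
  by rewrite /GRing.scale /= mulr0 add0r.
rewrite (le_trans (pairing_le _ _))//.
have xl : rn (x - comb e_bounded l) <= d / (rn Y + 1).
  by apply: cs_rn_le => [|i]; [rewrite ltW ?divr_gt0|rewrite csvalB; exact: lP].
rewrite (le_trans (ler_wpM2r (rn_ge0 _) xl))// -mulrA ler_piMr ?ltW//.
by rewrite mulrC ltr_pdivrMr// mul1r ltrDl.
Qed.

(** The norm of an element without dual and socle components is its supremum over
    [I]. *)
Lemma rn_le_rows F (M : R) : 0 <= M -> csval F None = 0 ->
  (forall x : ball1, csval F (Some (inr x)) = 0) ->
  (forall i, rn (csval F (Some (inl i)) : C) <= M) -> rn F <= M.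
Proof.
move=> M0 F0 Fr Fl; apply: cs_rn_le => // -[[i|x]|].
- exact: Fl.
- by rewrite Fr rn0.
- by rewrite F0 rn0.
Qed.

Lemma pmul_vec k Y : restr Y = 0 ->
  pmul (vec k) Y = (2^-1 * pairing (bvec k) Y) *: socle.
Proof. by move=> Y0; rewrite /pmul /form restr_vec Y0 pairing0l addr0. Qed.

Lemma socle_neq0 : socle <> 0.
Proof.
move=> /(congr1 (fun F => csval F None)); rewrite socleE csval0 => /eqP.
by rewrite oner_eq0.
Qed.

Lemma pairing_algebra_separable : separable_space pairing_algebra.
Proof. exact: (clspan_separable generator_bounded). Qed.

Lemma pairing_algebra_commutative : commutative_algebra pairing_algebra.
Proof. exact: pmulC. Qed.

End PairingAlgebra.

(** * Sign matrices with orthogonal columns and incoherent rows *)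
Lemma addb_xorb b c : b (+) c = xorb b c.
Proof. by case: b c => [] []. Qed.

Ltac xor_ring := rewrite ?addb_xorb; btauto.

Section SignMatrices.
Context {R : realType}.
Local Notation C := (R[i]).
Local Notation letter := (bool * bool)%type.
Local Notation word := (seq letter).
Local Notation row := (word * (letter * letter))%type.

Definition letters : seq letter :=
  [:: (false, false); (false, true); (true, false); (true, true)].

(** The words of length [k] stand for the elements of F_2^(2k) and index the
    vectors of level [k]. *)
Fixpoint words (k : nat) : seq word :=
  if k is k'.+1 then [seq t :: x | x <- words k', t <- letters] else [:: [::]].

Lemma wordsS k : words k.+1 = [seq t :: x | x <- words k, t <- letters].
Proof. by []. Qed.

Lemma sum_words (V : nmodType) k (F : word -> V) :
  \sum_(i <- words k.+1) F i = \sum_(x <- words k) \sum_(t <- letters) F (t :: x).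
Proof.
rewrite wordsS; exact: big_allpairs_dep.
Qed.

Lemma mem_letters t : t \in letters.
Proof. by case: t => -[] []. Qed.

Lemma mem_words k i : (i \in words k) = (size i == k).
Proof.
elim: k i => [|k IH] [|t x] //; rewrite wordsS.
  by apply/negbTE/negP => /allpairsP[] [? ?] [].
rewrite [size _]/= eqSS -IH; apply/idP/idP => [/allpairsP|xk].
  by move=> [[y u] /= [yk _ [_ ->]]].
by apply/allpairsP; exists (x, t); rewrite /= xk mem_letters.
Qed.

Lemma uniq_words k : uniq (words k).
Proof.
elim: k => // k IH; rewrite wordsS; apply: allpairs_uniq => // -[x t] [y u] _ _ /=.
by move=> [-> ->].
Qed.

Lemma size_words k : size (words k) = (4 ^ k)%N.
Proof. by elim: k => // k IH; rewrite wordsS size_allpairs IH expnSr. Qed.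

(** The standard inner product over F_2; words of different lengths are compared
    on their common length. *)
Fixpoint lin (a i : word) : bool :=
  match a, i with
  | b :: a', t :: x => lin a' x (+) (b.1 && t.1) (+) (b.2 && t.2)
  | _, _ => false
  end.

(** The quadratic form sum of c(l) x_l y_l over F_2. Positions are counted from the
    end of the word, so that prepending a letter does not move the others. *)
Fixpoint quad (c : nat -> bool) (i : word) : bool :=
  if i is t :: x then quad c x (+) (c (size x) && (t.1 && t.2)) else false.

Definition addl (b t : letter) : letter := (b.1 (+) t.1, b.2 (+) t.2).

Fixpoint addw (a i : word) : word :=
  match a, i with
  | b :: a', t :: x => addl b t :: addw a' x
  | _, _ => [::]
  end.

Lemma linC a i : lin a i = lin i a.
Proof.
by elim: a i => [|b a IH] [|t x] //=; rewrite IH (andbC b.1) (andbC b.2).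
Qed.

Lemma size_addw k a i : size a = k -> size i = k -> size (addw a i) = k.
Proof.
elim: k a i => [|k IH] [|b a] [|t x] //= [ak] [xk].
by rewrite IH.
Qed.

Lemma lin_addw a a' i : size a = size a' ->
  lin (addw a a') i = lin a i (+) lin a' i.
Proof.
elim: a a' i => [|b a IH] [|b' a'] [|t x] //= [aa]; rewrite (IH _ _ aa).
xor_ring.
Qed.

Lemma addw_eq0 k a a' : size a = k -> size a' = k ->
  (addw a a' == nseq k (false, false)) = (a == a').
Proof.
elim: k a a' => [|k IH] [|b a] [|b' a'] //= [ak] [ak'].
rewrite !eqseq_cons IH//; congr (_ && _).
by case: b b' => [[] []] [[] []].
Qed.

Lemma quad_add c c' i : quad (fun l => c l (+) c' l) i = quad c i (+) quad c' i.
Proof.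
elim: i => [|t x IH] //=; rewrite IH.
xor_ring.
Qed.

Lemma eq_quad c c' i : (forall l, (l < size i)%N -> c l = c' l) ->
  quad c i = quad c' i.
Proof.
elim: i => [|t x IH] //= cc; rewrite IH ?cc// => l lx.
by rewrite cc// ltnW.
Qed.

Local Notation sg b := ((-1) ^+ (nat_of_bool b) : C).

Lemma sgK b : sg b * sg b = 1.
Proof. by rewrite -expr2 sqrr_sign. Qed.

Lemma rn_sg b : rn (sg b) = 1.
Proof. by case: b; rewrite ?expr1 ?rnN ?rn1. Qed.

Definition letter_sum (c : bool) (b : letter) : C :=
  \sum_(t <- letters) sg ((b.1 && t.1) (+) (b.2 && t.2) (+) (c && (t.1 && t.2))).

Lemma letter_sum_le c b : rn (letter_sum c b) <= if c then 2 else 4.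
Proof.
have -> : letter_sum c b = if c then 2 * sg (b.1 && b.2)
    else if b == (false, false) then 4 else 0.
  rewrite /letter_sum !big_cons big_nil.
  by case: c b => -[[] []] /=; ring.
case: c; first by rewrite rnM rn_sg mulr1 rn_nat.
by case: ifP => _; rewrite ?rn_nat ?rn0.
Qed.

Lemma letter_sum0 b : b != (false, false) -> letter_sum false b = 0.
Proof.
by case: b => -[] [] //= _; rewrite /letter_sum !big_cons big_nil /=; ring.
Qed.

(** A Gauss sum over F_2. It is a product of sums over single letters
    ([char_sumS]), each of which equals 2 in absolute value where [c] holds, and
    elsewhere is 4 or 0 according to whether the letter of [a] is zero. *)
Definition char_sum c (a : word) k : C :=
  \sum_(i <- words k) sg (lin a i (+) quad c i).

Lemma char_sumS c b a k :
  char_sum c (b :: a) k.+1 = char_sum c a k * letter_sum (c k) b.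
Proof.
rewrite /char_sum sum_words mulr_suml [LHS]big_seq [RHS]big_seq.
apply: eq_bigr => x; rewrite mem_words => /eqP xk.
rewrite /letter_sum mulr_sumr; apply: eq_bigr => t _ /=.
rewrite xk -signr_addb; congr (_ ^+ nat_of_bool _).
xor_ring.
Qed.

Lemma char_sum0 c a k : size a = k -> (forall l, c l = false) ->
  a != nseq k (false, false) -> char_sum c a k = 0.
Proof.
move=> + c0; elim: k a => [|k IH] [|b a] //= [ak]; rewrite eqseq_cons negb_and.
rewrite char_sumS c0; case/orP => [b0|a0]; first by rewrite letter_sum0// mulr0.
by rewrite IH// mul0r.
Qed.

Definition eta k : R := 2^-1 ^+ (k %/ 5)%N.

Lemma eta_ge0 k : 0 <= eta k.
Proof. by rewrite exprn_ge0// invr_ge0. Qed.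

Lemma eta_nonincr k l : (k <= l)%N -> eta l <= eta k.
Proof.
by move=> kl; rewrite ler_wiXn2l ?leq_div2r ?invr_ge0// invf_le1// ler1n.
Qed.

(** If [c] holds along one residue class modulo 5, then one position out of five
    contributes a factor 1/2 to the character sum. *)
Lemma char_sum_le (c : nat -> bool) a k r : size a = k -> (r < 5)%N ->
  (forall l, (l < k)%N -> (l %% 5)%N = r -> c l) ->
  rn (char_sum c a k) <= 4 ^+ k * eta k.
Proof.
move=> ak r5 cr; suff : rn (char_sum c a k) <= 4 ^+ k * 2^-1 ^+ ((k + 4 - r) %/ 5)%N.
  move/le_trans; apply; rewrite ler_wpM2l ?exprn_ge0//.
  rewrite ler_wiXn2l ?invr_ge0// ?invf_le1 ?ler1n// leq_div2r//; lia.
elim: k a ak cr => [|k IH] [|b a] //= => [_ _|[ak] cr].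
  rewrite /char_sum big_seq1 /= rn1 expr0 mul1r divn_small ?expr0//; lia.
rewrite char_sumS rnM exprSr.
have -> : ((k.+1 + 4 - r) %/ 5 = (k + 4 - r) %/ 5 + (k %% 5 == r))%N.
  by case: eqP => kr; lia.
rewrite exprD mulrACA ler_pM ?rn_ge0//.
  by apply: IH => // l lk; apply: cr; rewrite ltnW.
rewrite (le_trans (letter_sum_le _ _))//; case: eqP => [kr|_].
  by rewrite cr//= expr1 [leRHS](_ : _ = 2)//; field.
by rewrite expr0 mulr1; case: ifP => // _; rewrite ler_nat.
Qed.

Lemma char_sum_one c a k : size a = k -> (forall l, c l = false) ->
  a = nseq k (false, false) -> char_sum c a k = 4 ^+ k.
Proof.
move=> + c0; elim: k a => [|k IH] [|b a] //=; first by rewrite /char_sum big_seq1 expr0.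
move=> [ak] [-> a0]; rewrite char_sumS IH// exprSr c0; congr (_ * _).
by rewrite /letter_sum !big_cons big_nil /=; ring.
Qed.

(** Orthogonality of the characters of F_2^(2k). *)
Lemma sum_lin k i i' : size i = k -> size i' = k ->
  \sum_(a <- words k) sg (lin a i (+) lin a i') = (i == i')%:R * 4 ^+ k.
Proof.
move=> ik ik'; have -> : \sum_(a <- words k) sg (lin a i (+) lin a i') =
    char_sum (fun=> false) (addw i i') k.
  apply: eq_bigr => a _; rewrite lin_addw ?ik ?ik'// !(linC a).
  suff -> : quad (fun=> false) a = false by rewrite addbF.
  by elim: a => //= t x ->.
have aik := size_addw ik ik'.
case: eqP => [|/eqP] ii'; last by rewrite mul0r char_sum0// addw_eq0.
by rewrite mul1r char_sum_one//; apply/eqP; rewrite addw_eq0// ii'.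
Qed.

(** Positions are split into the residue classes modulo 5. The four bits of a row
    switch the quadratic form on along the classes 0 to 3, and [twist] uses the
    remaining class, so that no combination of the former cancels it. *)
Definition sel (b : letter * letter) (l : nat) : bool :=
  nth false [:: b.1.1; b.1.2; b.2.1; b.2.2] (l %% 5)%N.

Definition twist (l : nat) : bool := (l %% 5 == 4)%N.

(** The row [g], with word of length [k], of the sign matrix of level [k]: [entry_a]
    gives the columns indexed by the words of length [k], and [entry_b s], for each
    bit [s], the columns indexed by the words of length [k.+1]. As functions of [g]
    they are characters of F_2^(2k+4), multiplied by a sign depending on the
    column: for [entry_a] the character (i, Q(i)), where Q is the vector of the four
    quadratic forms, and for [entry_b s] and the word [t :: x] the character
    (x, Q(x) + (1, s, t)). These characters are all different, so that the columns
    are orthogonal; the first offset bit separates [entry_b] from [entry_a], the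
    second one separates the two values of [s]. *)
Definition entry_a (g : row) (i : word) : bool := lin g.1 i (+) quad (sel g.2) i.

Definition entry_b (s : bool) (g : row) (j : word) : bool :=
  if j is t :: x then
    quad twist j (+) lin g.1 x (+) quad (sel g.2) x (+)
    (g.2.1.1 (+) (s && g.2.1.2) (+) (g.2.2.1 && t.1) (+) (g.2.2.2 && t.2))
  else false.

(** The product of two rows is a Gauss sum. If the quadratic parts differ then it is
    small, and if only the linear parts differ then it vanishes. *)
Lemma row_entry_a k (g h : row) : size g.1 = k -> size h.1 = k -> g != h ->
  rn (\sum_(i <- words k) sg (entry_a g i) * sg (entry_a h i)) <= 4 ^+ k * eta k.
Proof.
move=> gk hk gh; pose c l := sel g.2 l (+) sel h.2 l.
have -> : \sum_(i <- words k) sg (entry_a g i) * sg (entry_a h i) =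
    char_sum c (addw g.1 h.1) k.
  apply: eq_bigr => i _; rewrite -signr_addb; congr (_ ^+ nat_of_bool _).
  rewrite lin_addw ?gk// quad_add /entry_a.
  xor_ring.
have ghk := size_addw gk hk.
case: g h @c gk hk gh ghk => [a b] [a' b'] /= ak ak' gh aak.
case: (eqVneq b b') gh => [<- gh|bb' _].
  rewrite char_sum0 ?rn0 ?mulr_ge0 ?exprn_ge0 ?eta_ge0// => [l|].
    by rewrite addbb.
  by rewrite addw_eq0//; apply: contra gh => /eqP->.
have [r r4 br] : exists2 r, (r < 4)%N & forall l, (l %% 5)%N = r -> sel b l (+) sel b' l.
  case: b b' bb' => [[b1 b2] [b3 b4]] [[d1 d2] [d3 d4]] bb'.
  have [d1'|/negbTE e1] := boolP (b1 (+) d1).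
    by exists 0%N => // l lr; rewrite /sel lr.
  have [d2'|/negbTE e2] := boolP (b2 (+) d2).
    by exists 1%N => // l lr; rewrite /sel lr.
  have [d3'|/negbTE e3] := boolP (b3 (+) d3).
    by exists 2%N => // l lr; rewrite /sel lr.
  have [d4'|/negbTE e4] := boolP (b4 (+) d4).
    by exists 3%N => // l lr; rewrite /sel lr.
  move/eqP: bb'; case: b1 d1 b2 d2 b3 d3 b4 d4 e1 e2 e3 e4 => [] [] //= [] [] //= [] [] //= [] [] //.
by apply: (@char_sum_le _ _ _ r) => //; [exact: ltnW|move=> l _; exact: br].
Qed.

Lemma row_entry_b s k (g h : row) : size g.1 = k -> size h.1 = k -> g != h ->
  rn (\sum_(j <- words k.+1) sg (entry_b s g j) * sg (entry_b s h j)) <=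
    4 ^+ k.+1 * eta k.
Proof.
move=> gk hk gh; pose d (g : row) (t : letter) : bool :=
  g.2.1.1 (+) (s && g.2.1.2) (+) (g.2.2.1 && t.1) (+) (g.2.2.2 && t.2).
have -> : \sum_(j <- words k.+1) sg (entry_b s g j) * sg (entry_b s h j) =
    (\sum_(x <- words k) sg (entry_a g x) * sg (entry_a h x)) *
    \sum_(t <- letters) sg (d g t) * sg (d h t).
  rewrite sum_words mulr_suml; apply: eq_bigr => x _.
  rewrite mulr_sumr; apply: eq_bigr => t _.
  rewrite -!signr_addb; congr (_ ^+ nat_of_bool _); rewrite /entry_b /entry_a -!/(d _ t).
  xor_ring.
rewrite rnM exprSr mulrAC ler_pM ?rn_ge0 ?row_entry_a//.
rewrite (le_trans (rn_sum _ _ _))// (eq_bigr (fun=> 1)) => [|t _].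
  by rewrite big_const_seq /=; lra.
by rewrite rnM !rn_sg mulr1.
Qed.

(** Rows of consecutive levels meet on the words of length [k.+1]. There the twist
    forces a nonzero quadratic form on the class 4, whatever the two rows are. *)
Lemma row_entry_ba s k (g h : row) : size g.1 = k -> size h.1 = k.+1 ->
  rn (\sum_(j <- words k.+1) sg (entry_b s g j) * sg (entry_a h j)) <=
    4 ^+ k.+1 * eta k.+1.
Proof.
case: g h => [a [[b1 b2] b]] [[//|d a'] b'] /= ak [ak'].
pose c l := twist l (+) ((l < k)%N && sel ((b1, b2), b) l) (+) sel b' l.
have qE i : size i = k -> quad (sel ((b1, b2), b)) i =
    quad (fun l => (l < k)%N && sel ((b1, b2), b) l) i.
  by move=> ik; apply: eq_quad => l; rewrite ik => ->.
have -> : \sum_(j <- words k.+1) sg (entry_b s (a, ((b1, b2), b)) j) *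
      sg (entry_a (d :: a', b') j) =
    sg (b1 (+) (s && b2)) * char_sum c (addw (b :: a) (d :: a')) k.+1.
  rewrite /char_sum mulr_sumr [LHS]big_seq [RHS]big_seq.
  apply: eq_bigr => -[|t x]; rewrite mem_words //= => /eqP[xk].
  rewrite -!signr_addb; congr (_ ^+ nat_of_bool _).
  rewrite /entry_a /= lin_addw ?ak ?ak'//.
  rewrite -[quad c x (+) _]/(quad c (t :: x)) !quad_add /entry_b /=.
  rewrite xk ltnn /= addbF -qE//.
  xor_ring.
rewrite rnM rn_sg mul1r (@char_sum_le _ _ _ 4)// => [|l _ l4].
  by rewrite /= (size_addw ak ak').
by rewrite /c /twist /sel l4 /= andbF.
Qed.

Definition rows k : seq row :=
  [seq (a, b) | a <- words k, b <- [seq (t, u) | t <- letters, u <- letters]].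

Definition nrows k : R := 16 * 4 ^+ k.

Lemma sum_rows (V : nmodType) k (F : row -> V) : \sum_(g <- rows k) F g =
  \sum_(a <- words k) \sum_(t <- letters) \sum_(u <- letters) F (a, (t, u)).
Proof.
rewrite /rows big_allpairs_dep; apply: eq_bigr => a _.
exact: big_allpairs_dep.
Qed.

Lemma mem_rows k (g : row) : (g \in rows k) = (size g.1 == k).
Proof.
rewrite -mem_words /rows; case: g => a [t u]; apply/idP/idP => [/allpairsP|ak].
  by move=> [[a' b'] /= [ak _ [-> _]]].
apply/allpairsP; exists (a, (t, u)); split=> //.
by case: t u {ak} => [[] []] [[] []].
Qed.

Lemma size_rows k : (size (rows k))%:R = nrows k.
Proof.
rewrite /rows !size_allpairs size_words /nrows /= natrM natrX.
by rewrite mulrC.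
Qed.

Local Notation nrowsC k := ((nrows k)%:C : C).

Lemma column_aa k (i i' : word) : size i = k -> size i' = k ->
  \sum_(g <- rows k) sg (entry_a g i) * sg (entry_a g i') = (i == i')%:R * nrowsC k.
Proof.
move=> ik ik'; case: eqP => [<-|/eqP/negbTE ii'].
  under eq_bigr do rewrite sgK.
  by rewrite big_const_seq count_predT iter_addr_0 -size_rows rmorph_nat mul1r.
rewrite mul0r sum_rows exchange_big big1// => t _.
rewrite exchange_big big1// => u _.
rewrite (eq_bigr (fun a => sg (lin a i (+) lin a i') *
    sg (quad (sel (t, u)) i (+) quad (sel (t, u)) i'))) => [|a _].
  by rewrite -mulr_suml sum_lin// ii' !mul0r.
rewrite -!signr_addb /entry_a /=; congr (_ ^+ nat_of_bool _).
xor_ring.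
Qed.

Lemma column_ab s k (i j : word) : size i = k -> size j = k.+1 ->
  \sum_(g <- rows k) sg (entry_a g i) * sg (entry_b s g j) = 0.
Proof.
case: j => // t x ik [xk]; rewrite sum_rows.
case: (eqVneq i x) => [->|/negbTE ix].
  rewrite big1// => a _; rewrite (eq_bigr (fun b : letter =>
    \sum_(u <- letters) sg (quad twist (t :: x) (+)
      (b.1 (+) (s && b.2) (+) (u.1 && t.1) (+) (u.2 && t.2))))) => [|b _].
    rewrite /letters !big_cons !big_nil; move: (quad twist (t :: x)) => q.
    by move: q t.1 t.2 s => [] [] [] [] /=; ring.
  apply: eq_bigr => u _; rewrite -signr_addb; congr (_ ^+ nat_of_bool _).
  rewrite /entry_a /entry_b /=.
  xor_ring.
rewrite exchange_big big1// => b _; rewrite exchange_big big1// => u _.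
rewrite (eq_bigr (fun a => sg (lin a i (+) lin a x) *
   sg (quad (sel (b, u)) i (+) quad twist (t :: x) (+) quad (sel (b, u)) x (+)
      (b.1 (+) (s && b.2) (+) (u.1 && t.1) (+) (u.2 && t.2))))) => [|a _].
  by rewrite -mulr_suml sum_lin// ix !mul0r.
rewrite -!signr_addb; congr (_ ^+ nat_of_bool _).
rewrite /entry_a /entry_b /=; xor_ring.
Qed.

Lemma column_bb s s' k (j j' : word) : size j = k.+1 -> size j' = k.+1 ->
  \sum_(g <- rows k) sg (entry_b s g j) * sg (entry_b s' g j') =
    ((s == s') && (j == j'))%:R * nrowsC k.
Proof.
case: j j' => // t x [] // t' x' [xk] [xk'].
have [[-> -> ->]|sj] := eqVneq (s, t :: x) (s', t' :: x').
  rewrite !eqxx; under eq_bigr do rewrite sgK.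
  by rewrite big_const_seq count_predT iter_addr_0 -size_rows rmorph_nat mul1r.
have -> : (s == s') && (t :: x == t' :: x') = false by apply/negbTE.
rewrite mul0r sum_rows.
case: (eqVneq x x') sj => [<-{x' xk'} sj|/negbTE xx' _].
  rewrite big1// => a _; rewrite (eq_bigr (fun b : letter =>
    \sum_(u <- letters) sg (quad twist (t :: x) (+) quad twist (t' :: x) (+)
      (((s (+) s') && b.2) (+) (u.1 && (t.1 (+) t'.1)) (+) (u.2 && (t.2 (+) t'.2)))))) => [|b _].
    have : [|| s (+) s', t.1 (+) t'.1 | t.2 (+) t'.2].
      apply: contraNT sj; case: s s' t t' => [] [] [[] []] [[] []] //=.
    rewrite /letters !big_cons !big_nil.
    move: (quad _ (t :: x) (+) quad _ (t' :: x)) => q.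
    move: q (s (+) s') (t.1 (+) t'.1) (t.2 (+) t'.2).
    by move=> [] [] [] [] //= _; ring.
  apply: eq_bigr => u _; rewrite -signr_addb; congr (_ ^+ nat_of_bool _).
  rewrite /entry_b /=; xor_ring.
rewrite exchange_big big1// => b _; rewrite exchange_big big1// => u _.
rewrite (eq_bigr (fun a => sg (lin a x (+) lin a x') *
   sg (quad twist (t :: x) (+) quad (sel (b, u)) x (+)
      (b.1 (+) (s && b.2) (+) (u.1 && t.1) (+) (u.2 && t.2)) (+)
      (quad twist (t' :: x') (+) quad (sel (b, u)) x' (+)
      (b.1 (+) (s' && b.2) (+) (u.1 && t'.1) (+) (u.2 && t'.2)))))) => [|a _].
  by rewrite -mulr_suml sum_lin// xx' !mul0r.
rewrite -!signr_addb; congr (_ ^+ nat_of_bool _); rewrite /entry_b /=.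
xor_ring.
Qed.

End SignMatrices.

(** * The algebras attached to binary sequences *)
Section DavieAlgebra.
Context {R : realType}.
Local Notation C := (R[i]).
Local Notation letter := (bool * bool)%type.
Local Notation word := (seq letter).
Local Notation row := (word * (letter * letter))%type.
Local Notation sg b := ((-1) ^+ (nat_of_bool b) : C).
Implicit Types (s : nat -> bool) (i j : word) (g h : row).

(** A vector of level [k] is a function on all rows that is nonzero on the rows of
    the levels [k] and [k-1] only. *)
Definition basis s (i : word) (g : row) : C^o :=
  if size i == size g.1 then sg (entry_a g i)
  else if size i == (size g.1).+1 then sg (entry_b (s (size g.1)) g i) else 0.

Lemma basis_le1 s i : bounded_by 1 (basis s i).
Proof.
by move=> g; rewrite /basis; do 2?case: ifP => _; rewrite ?rn_sg ?rn0.
Qed.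

Definition davie s : banachAlgebra R := pairing_algebra (basis_le1 s).

Local Notation space s := (clspan (generator (e := basis s))).

Definition davie_vec s i : space s := vec (basis_le1 s) i.
Definition davie_eval s g : space s := ev (basis_le1 s) g.
Definition davie_socle s : space s := socle (basis_le1 s).

(** The coordinate functional of [davie_vec s i], by orthogonality of columns
    ([pair_dual]). *)
Definition davie_dual s (i : word) : space s := ((nrows (size i))^-1%:C : C) *:
  \sum_(g <- rows (size i)) sg (entry_a g i) *: davie_eval s g.

Definition davie_small s (g : row) : space s :=
  (4 ^- size g.1 : C) *: (\sum_(i <- words (size g.1)) sg (entry_a g i) *: davie_vec s i) -
  (4 ^- (size g.1).+1 : C) *:
    (\sum_(j <- words (size g.1).+1) sg (entry_b (s (size g.1)) g j) *: davie_vec s j).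

Lemma nrows_gt0 k : 0 < nrows k :> R.
Proof. by rewrite mulr_gt0// exprn_gt0. Qed.

Lemma rn_rows_avg (V : normedModType C) k (F : row -> V) (M : R) :
  (forall g, g \in rows k -> rn (F g) <= M) ->
  rn (((nrows k)^-1%:C : C) *: \sum_(g <- rows k) F g) <= M.
Proof.
move=> FM; rewrite rnZ rn_real ger0_norm ?invr_ge0 ?(ltW (nrows_gt0 _))//.
rewrite ler_pdivrMl ?nrows_gt0// (le_trans (rn_sum _ _ _))//.
rewrite big_seq (le_trans (ler_sum _ (fun g => FM g)))// -big_seq.
by rewrite big_const_seq count_predT iter_addr_0 -size_rows mulr_natl.
Qed.

Lemma rn_davie_dual s i : rn (davie_dual s i) <= 1.
Proof.
apply: rn_rows_avg => g _; rewrite rnZ rn_sg mul1r; exact: rn_ev.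
Qed.

(** The pairing of the small vector of a row with itself is 1 - 1; its pairings with
    other rows are products of different rows, at the same or a neighbouring level. *)
Lemma davie_small_row s g h : rn (csval (davie_small s g) (Some (inl h)) : C) <= 2 * eta (size g.1).
Proof.
set k := size g.1.
have -> : csval (davie_small s g) (Some (inl h)) =
   4 ^- k * (\sum_(i <- words k) sg (entry_a g i) * basis s i h) -
   4 ^- k.+1 * (\sum_(j <- words k.+1) sg (entry_b (s k) g j) * basis s j h) :> C.
  rewrite /davie_small csvalB !csvalZ !csval_sum; congr (_ * _ - _ * _);
    by apply: eq_bigr => i _; rewrite csvalZ vecE.
have sumE l (F G : word -> C) : (forall i, size i = l -> F i = G i) ->
    \sum_(i <- words l) F i = \sum_(i <- words l) G i.
  move=> FG; rewrite [LHS]big_seq [RHS]big_seq; apply: eq_bigr => i.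
  by rewrite mem_words => /eqP/FG.
have avg_le l (z : C) (M : R) : rn z <= 4 ^+ l * M -> rn (4 ^- l * z) <= M.
  move=> zM; rewrite rnM rnV -natrX rn_nat natrX ler_pdivrMl ?exprn_gt0//.
have e0 := eta_ge0 k : 0 <= eta k :> R.
have [hk|hk] := eqVneq (size h.1) k.
  rewrite (@sumE k _ (fun i => sg (entry_a g i) * sg (entry_a h i))); last first.
    by move=> i ik; rewrite /basis ik hk eqxx.
  rewrite (@sumE k.+1 _ (fun j => sg (entry_b (s k) g j) * sg (entry_b (s k) h j))); last first.
    by move=> i ik; rewrite /basis ik hk eqxx gtn_eqF.
  have [<-|gh] := eqVneq g h.
    under eq_bigr do rewrite sgK.
    under [in X in _ - X]eq_bigr do rewrite sgK.
    have sum1 l : 4 ^- l * \sum_(i <- words l) 1 = 1 :> C.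
      have l0 : 4 ^+ l != 0 :> C by rewrite expf_eq0 pnatr_eq0 andbF.
      by rewrite big_const_seq count_predT iter_addr_0 size_words natrX mulVf.
    by rewrite !sum1 subrr rn0 mulr_ge0.
  rewrite mulr2n mulrDl mul1r (le_trans (rnB _ _))// lerD//; apply: avg_le.
    exact: row_entry_a.
  exact: row_entry_b.
have [hk1|hk1] := eqVneq (size h.1) k.+1.
  rewrite (@sumE k _ (fun=> 0)); last first.
    by move=> i ik; rewrite /basis ik hk1 !ltn_eqF ?mulr0// ltnW.
  rewrite big1_eq mulr0 sub0r rnN.
  rewrite (@sumE k.+1 _ (fun j => sg (entry_b (s k) g j) * sg (entry_a h j))); last first.
    by move=> i ik; rewrite /basis ik hk1 eqxx.
  rewrite (@le_trans _ _ (eta k.+1))//; first exact/avg_le/row_entry_ba.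
  rewrite (le_trans (@eta_nonincr _ k k.+1 _))//; lra.
rewrite (@sumE k.+1 _ (fun=> 0)); last first.
  move=> i ik; rewrite /basis ik (eq_sym k.+1) (negbTE hk1) eqSS (eq_sym k) (negbTE hk).
  by rewrite mulr0.
rewrite big1_eq mulr0 subr0.
have [hk2|hk2] := eqVneq (size h.1).+1 k.
  rewrite (@sumE k _ (fun i => sg (entry_b (s (size h.1)) h i) * sg (entry_a g i))); last first.
    by move=> i ik; rewrite /basis ik -hk2 eqxx gtn_eqF// mulrC.
  apply: avg_le; rewrite -hk2.
  have := @row_entry_ba R (s (size h.1)) (size h.1) h g erefl (esym hk2).
  move/le_trans; apply; rewrite ler_wpM2l ?exprn_ge0//.
  by rewrite ler_peMl ?eta_ge0// ler1n.
rewrite (@sumE k _ (fun=> 0)) ?big1_eq ?mulr0 ?rn0 ?mulr_ge0// => i ik.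
by rewrite /basis ik eq_sym (negbTE hk) eq_sym (negbTE hk2) mulr0.
Qed.

Lemma rn_davie_small s g : rn (davie_small s g) <= 2 * eta (size g.1).
Proof.
have sumN l (c : word -> C) (t : point (basis s)) :
    (forall i, csval (davie_vec s i) t = 0) ->
    csval (\sum_(i <- words l) c i *: davie_vec s i) t = 0.
  by move=> t0; rewrite csval_sum big1// => i _; rewrite csvalZ t0 mulr0.
have offrows (t : point (basis s)) : (forall i, csval (davie_vec s i) t = 0) ->
    csval (davie_small s g) t = 0.
  by move=> t0; rewrite csvalB !csvalZ !sumN// !mulr0 subrr.
apply: rn_le_rows; first by rewrite mulr_ge0 ?eta_ge0.
- by apply: offrows => i; rewrite vecE.
- by move=> x; apply: offrows => i; rewrite vecE.
- exact: davie_small_row.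
Qed.

Definition pair s i (G : space s) : C := pairing (bvec (basis_le1 s) i) G.

Lemma pair_eval s i g : pair i (davie_eval s g) = basis s i g.
Proof. by rewrite /pair pairing_ev bvecE. Qed.

Lemma pair_dual s i j : pair j (davie_dual s i) = (j == i)%:R.
Proof.
rewrite /pair pairingZr pairing_sumr.
rewrite (eq_big_seq (fun g => sg (entry_a g i) *
    (if size j == size i then sg (entry_a g j)
     else if size j == (size i).+1 then sg (entry_b (s (size i)) g j) else 0))); last first.
  move=> g; rewrite mem_rows => /eqP gi.
  by rewrite pairingZr -/(pair j (davie_eval s g)) pair_eval /basis gi.
have [ji|ji] := eqVneq (size j) (size i).
  have n0 : nrows (size i) != 0 :> R by rewrite lt0r_neq0// nrows_gt0.
  by rewrite column_aa// mulrCA -rmorphM mulVf// rmorph1 mulr1 eq_sym.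
have [ji1|_] := eqVneq (size j) (size i).+1.
  rewrite column_ab// mulr0; case: eqP => // ij; move: ji.
  by rewrite ij eqxx.
rewrite big1 => [|g _]; last by rewrite mulr0.
by rewrite mulr0; case: eqP => // ij; move: ji; rewrite ij eqxx.
Qed.

Lemma restr_dual_sum s (r : seq word) (c : word -> C) :
  restr (\sum_(i <- r) c i *: davie_dual s i : space s) = 0.
Proof.
apply: csval_inj; apply/funext => h; rewrite restrE csval0 csval_sum big1// => i _.
rewrite csvalZ /davie_dual csvalZ csval_sum big1 ?mulr0// => g _.
by rewrite csvalZ evE mulr0.
Qed.

Lemma sum_words_eq k (c : word -> C) j :
  \sum_(i <- words k) c i * (j == i)%:R = if size j == k then c j else 0.
Proof.
rewrite -mem_words; case: ifP => jk.
  rewrite (bigD1_seq j) ?uniq_words//= eqxx mulr1 big1 ?addr0// => i ij.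
  by rewrite eq_sym (negbTE ij) mulr0.
rewrite big_seq big1// => i ik; case: eqP => [ji|_]; last by rewrite mulr0.
by rewrite ji ik in jk.
Qed.

(** The reason for taking functionals on [X] rather than free vectors: each
    evaluation is a signed sum of coordinate functionals of two levels. *)
Lemma eval_decomposition s g : davie_eval s g =
  \sum_(i <- words (size g.1)) sg (entry_a g i) *: davie_dual s i +
  \sum_(j <- words (size g.1).+1) sg (entry_b (s (size g.1)) g j) *: davie_dual s j.
Proof.
apply/eqP; rewrite -subr_eq0; apply/eqP; apply: (functional_eq0 (e_le1 := basis_le1 s)).
- rewrite csvalB csvalD evE !csval_sum !big1 ?addr0 ?subr0// => i _;
  rewrite csvalZ /davie_dual csvalZ csval_sum big1 ?mulr0// => h _;
  by rewrite csvalZ evE mulr0.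
- have rB (F G : space s) : restr (F - G) = restr F - restr G.
    by rewrite -[F - G]addrC -scaleN1r restr_linear scaleN1r addrC.
  have rD (F G : space s) : restr (F + G) = restr F + restr G.
    by have := restr_linear 1 F G; rewrite !scale1r.
  by rewrite rB rD !restr_dual_sum addr0 subr0 restr_ev.
move=> j; rewrite pairingBr pairingDr !pairing_sumr -/(pair j (davie_eval s g)) pair_eval.
rewrite (eq_bigr (fun i => sg (entry_a g i) * (j == i)%:R)); last first.
  by move=> i _; rewrite pairingZr -/(pair j (davie_dual s i)) pair_dual.
rewrite [X in _ - (_ + X)](eq_bigr (fun i => sg (entry_b (s (size g.1)) g i) * (j == i)%:R)); last first.
  by move=> i _; rewrite pairingZr -/(pair j (davie_dual s i)) pair_dual.
rewrite !sum_words_eq /basis; case: eqP => [->|_].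
  by rewrite ltn_eqF// addr0 subrr.
by case: ifP => _; rewrite [X in _ - X]add0r subrr.
Qed.

Lemma mul_vec_dual s i : bmul (davie_vec s i : davie s) (davie_dual s i) = (2^-1 : C) *: davie_socle s.
Proof.
have := restr_dual_sum s [:: i] (fun=> 1).
rewrite big_seq1 scale1r => d0.
rewrite /bmul /= pmul_vec// -/(pair i (davie_dual s i)) pair_dual eqxx mulr1//.
Qed.

Lemma davie_socle_neq0 s : davie_socle s <> 0.
Proof. exact: socle_neq0. Qed.

Lemma davie_separable s : separable_space (davie s).
Proof. exact: pairing_algebra_separable. Qed.

Lemma davie_commutative s : commutative_algebra (davie s).
Proof. exact: pairing_algebra_commutative. Qed.

End DavieAlgebra.

(** * Telescoping across two homomorphisms *)
Section LinearMaps.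
Context {K : pzRingType} {V W : lmodType K} {f : V -> W}.
Hypothesis f_linear : linear f.

Lemma raw_lin0 : f 0 = 0.
Proof. by have := f_linear (-1) 0 0; rewrite scaler0 addr0 scaleN1r addNr. Qed.

Lemma raw_linD x y : f (x + y) = f x + f y.
Proof. by have := f_linear 1 x y; rewrite !scale1r. Qed.

Lemma raw_linZ a x : f (a *: x) = a *: f x.
Proof. by rewrite -[a *: x]addr0 f_linear raw_lin0 addr0. Qed.

Lemma raw_linB x y : f (x - y) = f x - f y.
Proof. by rewrite -!scaleN1r raw_linD raw_linZ. Qed.

Lemma raw_lin_sum (I : Type) (r : seq I) (F : I -> V) :
  f (\sum_(i <- r) F i) = \sum_(i <- r) f (F i).
Proof.
by elim: r => [|i r IH]; rewrite ?big_nil ?raw_lin0// !big_cons raw_linD IH.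
Qed.

End LinearMaps.

Section Telescoping.
Context {R : realType} {B : banachAlgebra R} {s s' : nat -> bool}.
Local Notation C := (R[i]).
Local Notation letter := (bool * bool)%type.
Local Notation word := (seq letter).
Local Notation row := (word * (letter * letter))%type.
Local Notation sg b := ((-1) ^+ (nat_of_bool b) : C).
Local Notation davie := (@davie R).
Variables (f : davie s -> B) (f' : davie s' -> B) (M : R).
Hypotheses (f_linear : linear f) (f'_linear : linear f') (M_ge0 : 0 <= M).
Hypotheses (f_le : forall x, rn (f x) <= M * rn x)
  (f'_le : forall x, rn (f' x) <= M * rn x).

Lemma rn_bmul (x y : B) : rn (bmul x y) <= rn x * rn y.
Proof. by rewrite -lecR rmorphM /= -!rnE bmul_norm. Qed.

(** The value of f (x) f' on the average of the tensors e_i (x) e'_i of level [k]. *)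
Definition trace k : B :=
  (4 ^- k : C) *: \sum_(i <- words k) bmul (f (davie_vec s i)) (f' (davie_dual s' i)).

Lemma bmul_sums (J : Type) (r : seq J) (r1 r2 : seq word) (p q : J -> word -> C)
    (E D : word -> B) :
  \sum_(g <- r) bmul (\sum_(i <- r1) p g i *: E i) (\sum_(j <- r2) q g j *: D j) =
  \sum_(i <- r1) \sum_(j <- r2) (\sum_(g <- r) p g i * q g j) *: bmul (E i) (D j).
Proof.
under [RHS]eq_bigr do under eq_bigr do rewrite scaler_suml.
under [RHS]eq_bigr do rewrite exchange_big.
rewrite [RHS]exchange_big; apply: eq_bigr => g _ /=.
rewrite (raw_lin_sum (bmul_linearl _)); apply: eq_bigr => i _.
rewrite (raw_linZ (bmul_linearl _)) (raw_lin_sum (bmul_linearr _)) scaler_sumr.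
by apply: eq_bigr => j _; rewrite (raw_linZ (bmul_linearr _)) scalerA.
Qed.

Lemma bmul_sums_diag (J : Type) (r : seq J) k (p q : J -> word -> C)
    (E D : word -> B) (c : C) :
  (forall i j, size i = k -> size j = k ->
    \sum_(g <- r) p g i * q g j = (i == j)%:R * c) ->
  \sum_(g <- r) bmul (\sum_(i <- words k) p g i *: E i)
      (\sum_(j <- words k) q g j *: D j) =
  c *: \sum_(i <- words k) bmul (E i) (D i).
Proof.
move=> pq; rewrite bmul_sums scaler_sumr; apply: eq_big_seq => i ik.
rewrite (bigD1_seq i) ?uniq_words//= pq ?eqxx ?mul1r; first last.
- by move: ik; rewrite mem_words => /eqP.
- by move: ik; rewrite mem_words => /eqP.
rewrite big_seq_cond big1 ?addr0// => j /andP[jk ji].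
move: ik jk; rewrite !mem_words => /eqP ik /eqP jk.
by rewrite pq// eq_sym (negbTE ji) mul0r scale0r.
Qed.

Lemma bmul_sums0 (J : Type) (r : seq J) k l (p q : J -> word -> C)
    (E D : word -> B) :
  (forall i j, size i = k -> size j = l -> \sum_(g <- r) p g i * q g j = 0) ->
  \sum_(g <- r) bmul (\sum_(i <- words k) p g i *: E i)
      (\sum_(j <- words l) q g j *: D j) = 0.
Proof.
move=> pq; rewrite bmul_sums big_seq big1// => i; rewrite mem_words => /eqP ik.
rewrite big_seq big1// => j; rewrite mem_words => /eqP jl.
by rewrite pq// scale0r.
Qed.

(** The mixed terms vanish as [entry_a] and [entry_b] have orthogonal columns. The
    columns chosen by [s k] and [s' k] are equal or orthogonal, which decides whether
    the next level contributes. *)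
Lemma row_average k :
  ((nrows k)^-1%:C : C) *:
    \sum_(g <- rows k) bmul (f (davie_small s g)) (f' (davie_eval s' g)) =
  trace k - (s k == s' k)%:R *: trace k.+1.
Proof.
pose E i := f (davie_vec s i); pose D i := f' (davie_dual s' i).
pose Ea g := \sum_(i <- words k) sg (entry_a g i) *: E i.
pose Eb g := \sum_(j <- words k.+1) sg (entry_b (s k) g j) *: E j.
pose Da g := \sum_(i <- words k) sg (entry_a g i) *: D i.
pose Db g := \sum_(j <- words k.+1) sg (entry_b (s' k) g j) *: D j.
have -> : \sum_(g <- rows k) bmul (f (davie_small s g)) (f' (davie_eval s' g)) =
    (4 ^- k : C) *: (\sum_(g <- rows k) bmul (Ea g) (Da g) +
      \sum_(g <- rows k) bmul (Ea g) (Db g)) -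
    (4 ^- k.+1 : C) *: (\sum_(g <- rows k) bmul (Eb g) (Da g) +
      \sum_(g <- rows k) bmul (Eb g) (Db g)).
  rewrite -!big_split !scaler_sumr -sumrB; apply: eq_big_seq => g.
  rewrite mem_rows => /eqP gk.
  have -> : f (davie_small s g) = (4 ^- k : C) *: Ea g - (4 ^- k.+1 : C) *: Eb g.
    rewrite /davie_small gk (raw_linB f_linear) !(raw_linZ f_linear).
    rewrite !(raw_lin_sum f_linear); congr (_ *: _ - _ *: _);
    by apply: eq_bigr => i _; rewrite (raw_linZ f_linear).
  have -> : f' (davie_eval s' g) = Da g + Db g.
    rewrite eval_decomposition gk (raw_linD f'_linear).
    rewrite !(raw_lin_sum f'_linear); congr (_ + _);
    by apply: eq_bigr => i _; rewrite (raw_linZ f'_linear).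
  rewrite (raw_linB (bmul_linearl _)) !(raw_linZ (bmul_linearl _)).
  by rewrite !(raw_linD (bmul_linearr _)).
rewrite (@bmul_sums_diag _ _ _ _ _ _ _ ((nrows k)%:C)); last exact: column_aa.
rewrite bmul_sums0; last exact: column_ab.
rewrite (@bmul_sums0 _ _ _ _ (fun g j => sg (entry_b (s k) g j))); last first.
  move=> i j ik jk; under eq_bigr do rewrite mulrC.
  exact: column_ab.
rewrite addr0 add0r.
have -> : \sum_(g <- rows k) bmul (Eb g) (Db g) = (s k == s' k)%:R *:
    ((nrows k)%:C *: \sum_(i <- words k.+1) bmul (E i) (D i)).
  case: eqP => [ss|/eqP ss].
    rewrite scale1r /Eb /Db -ss; apply: bmul_sums_diag => i j ik jk.
    by rewrite column_bb// eqxx.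
  rewrite scale0r; apply: bmul_sums0 => i j ik jk.
  by rewrite column_bb// (negbTE ss) mul0r.
have nV : ((nrows k)^-1%:C * (nrows k)%:C : C) = 1.
  by rewrite -rmorphM mulVf ?rmorph1// lt0r_neq0// nrows_gt0.
rewrite scalerBr /trace !scalerA; congr (_ *: _ - _ *: _).
  by rewrite mulrCA nV mulr1.
by rewrite mulrCA nV mulr1 mulrC.
Qed.

Lemma rn_step k : rn (trace k) <= 2 * M ^+ 2 * eta k +
  (s k == s' k)%:R * rn (trace k.+1).
Proof.
have := row_average k; set avg := LHS; move=> avgE.
have -> : trace k = avg + (s k == s' k)%:R *: trace k.+1 by rewrite avgE subrK.
rewrite (le_trans (rnD _ _))// lerD//; last by rewrite rnZ rn_nat.
apply: rn_rows_avg => g; rewrite mem_rows => /eqP gk.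
rewrite (le_trans (rn_bmul _ _))//.
have -> : 2 * M ^+ 2 * eta k = (M * (2 * eta k)) * (M * 1) by ring.
rewrite ler_pM ?rn_ge0//.
  by rewrite (le_trans (f_le _))// ler_wpM2l// -gk rn_davie_small.
by rewrite (le_trans (f'_le _))// ler_wpM2l// rn_ev.
Qed.

(** The sum of [eta l] over [l >= k]: each power of 1/2 occurs five times. *)
Definition tail k : R := (10 - (k %% 5)%:R) * eta k.

Lemma tailS k : tail k = eta k + tail k.+1.
Proof.
rewrite /tail /eta; have [k4|k4] := eqVneq (k %% 5)%N 4%N.
  have -> : (k.+1 %/ 5 = (k %/ 5).+1)%N by lia.
  have -> : (k.+1 %% 5 = 0)%N by lia.
  by rewrite k4 exprS; field.
have -> : (k.+1 %/ 5 = k %/ 5)%N by lia.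
have -> : (k.+1 %% 5 = (k %% 5).+1)%N by lia.
by rewrite -natr1; ring.
Qed.

Lemma eta_le_tail k : eta k <= tail k.
Proof.
rewrite /tail ler_peMl ?eta_ge0// lerBrDr nat1r ler_nat.
by rewrite (leq_trans (ltn_pmod k (isT : (0 < 5)%N))).
Qed.

Lemma rn_trace k n : (k <= n)%N -> s n != s' n ->
  (forall l, (k <= l < n)%N -> s l = s' l) ->
  rn (trace k) <= 2 * M ^+ 2 * tail k.
Proof.
move=> kn sn; elim: {k}(n - k)%N {-2}k (erefl (n - k)%N) kn => [|d IH] k nk kn sl.
  have -> : k = n by lia.
  rewrite (le_trans (rn_step _))// (negbTE sn) mul0r addr0.
  by rewrite ler_wpM2l ?eta_le_tail// mulr_ge0// exprn_ge0.
rewrite (le_trans (rn_step _))// tailS mulrDr lerD2l.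
rewrite sl ?eqxx ?mul1r; last by lia.
by apply: IH => [||l kl]; [lia|lia|apply: sl; lia].
Qed.

(** If f and f' were equal on the level [k], the trace would be an average of terms
    f'(e_i e'_i) = f'(z) / 2. *)
Lemma rn_socle_image k (e : R) :
  (forall x y, f' (bmul x y) = bmul (f' x) (f' y)) ->
  (forall i, size i = k -> rn (f (davie_vec s i) - f' (davie_vec s' i)) <= e) ->
  rn (f' (davie_socle s')) <= 2 * (rn (trace k) + e * M).
Proof.
move=> f'M fe.
have zE : (2^-1 : C) *: f' (davie_socle s') = trace k -
    (4 ^- k : C) *: \sum_(i <- words k)
      bmul (f (davie_vec s i) - f' (davie_vec s' i)) (f' (davie_dual s' i)).
  rewrite /trace -scalerBr -sumrB; under eq_bigr => i _.
    rewrite (raw_linB (bmul_linearl _)) subKr -f'M mul_vec_dual (raw_linZ f'_linear).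
    over.
  rewrite big_const_seq count_predT iter_addr_0 size_words -[_ *+ (4 ^ k)%N]scaler_nat scalerA.
  by rewrite natrX mulVf ?scale1r// expf_eq0 pnatr_eq0 andbF.
have : rn ((2^-1 : C) *: f' (davie_socle s')) <= rn (trace k) + e * M.
  rewrite zE (le_trans (rnB _ _))// lerD2l rnZ rnV -natrX rn_nat.
  rewrite ler_pdivrMl ?ltr0n ?expn_gt0// (le_trans (rn_sum _ _ _))//.
  rewrite big_seq (@le_trans _ _ (\sum_(i <- words k | i \in words k) (e * M)))//.
    apply: ler_sum => i; rewrite mem_words => /eqP ik.
    rewrite (le_trans (rn_bmul _ _))// ler_pM ?rn_ge0 ?fe//.
    by rewrite (le_trans (f'_le _))// ler_piMr// rn_davie_dual.
  rewrite -big_seq big_const_seq count_predT iter_addr_0 size_words.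
  by rewrite mulr_natl.
by rewrite rnZ rnV rn_nat ler_pdivrMl.
Qed.

End Telescoping.

(** * Pigeonhole over binary sequences *)
Section Pigeonhole.
Context {R : realType}.
Local Notation C := (R[i]).

(** Cantor: the space of binary sequences does not inject into a countable type. *)
Lemma countable_code_collision (K : countType) (code : (nat -> bool) -> K) :
  exists s s', code s = code s' /\ s <> s'.
Proof.
apply: contrapT => Ncode.
have code_inj s s' : code s = code s' -> s = s'.
  by move=> ss'; apply: contrapT => neq; apply: Ncode; exists s, s'.
pose t n := `[< forall s, pickle (code s) = n -> s n = false >].
have tE : t (pickle (code t)) = ~~ t (pickle (code t)).
  apply/idP/idP => [/asboolP/(_ t erefl) ->//|tn].
  apply/asboolP => s /(pcan_inj pickleK)/code_inj ->; exact: negbTE.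
by case: (t _) tE.
Qed.

Lemma bounded_op_le (V W : normedModType C) (f : V -> W) :
  linear f -> bounded_op f -> exists n : nat, forall x, rn (f x) <= n%:R * rn x.
Proof.
move=> f_linear fb.
have f_ub x : rn x <= 1 -> ((rn (f x))%:E <= opnorm f)%E.
  by move=> x1; apply: ereal_sup_ubound; exists x => //=; rewrite rnE lecR.
have [r fr] : exists r : R, forall x, rn x <= 1 -> rn (f x) <= r.
  move: fb f_ub; rewrite /bounded_op; case: (opnorm f) => [r|//|] _ f_ub.
    by exists r => x /f_ub; rewrite lee_fin.
  by have := f_ub 0; rewrite rn0 ler01 => /(_ isT).
exists (Num.truncn r).+1 => x; have [x0|x0] := eqVneq (rn x) 0.
  by rewrite (rn_eq0 x0) (raw_lin0 f_linear) !rn0 mulr0.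
have xgt0 : 0 < rn x by rewrite lt_neqAle eq_sym x0 rn_ge0.
have x1 : rn ((rn x)^-1%:C *: x) <= 1.
  by rewrite rnZ rn_real ger0_norm ?invr_ge0 ?rn_ge0// mulVf.
have := fr _ x1; rewrite (raw_linZ f_linear) rnZ rn_real.
rewrite ger0_norm ?invr_ge0 ?rn_ge0// ler_pdivrMl// mulrC => /le_trans; apply.
by rewrite ler_wpM2r ?rn_ge0// ltW// truncnS_gt.
Qed.

Lemma separable_code (V : normedModType C) : separable_space V ->
  forall e : R, 0 < e -> exists c : V -> nat,
    forall x y, c x = c y -> rn (x - y) <= e.
Proof.
move=> [D [/countable_injP[c c_inj] Dd]] e e0.
have e20 : 0 < e / 2 by rewrite divr_gt0.
have /choice[p pP] x : exists d, D d /\ rn (x - d) <= e / 2.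
  have [||d [xd Dd']] := Dd (ball x (e / 2)%:C)°.
  - exists x; apply: nbhsx_ballx; by rewrite ltcR.
  - exact: open_interior.
  exists d; split => //.
  have := interior_subset xd; rewrite -ball_normE /= rnE ltcR => /ltW.
  by [].
exists (fun x => c (p x)) => x y cxy.
have pxy : p x = p y.
  by apply: c_inj => //; rewrite inE; have [] := pP x; have [] := pP y.
rewrite (le_trans (rn_triangle (p x) _ _))// (splitr e) lerD//.
  by have [] := pP x.
by rewrite rnC pxy; have [] := pP y.
Qed.

Lemma tail_small (c : R) : 0 <= c -> exists k : nat, c * @tail R k <= 1.
Proof.
move=> c0; pose n := (Num.truncn (10 * c)).+1; exists (n * 5)%N.
rewrite /tail /eta modnMl mulnK// subr0 exprVn.
have n2 : (n%:R : R) <= 2 ^+ n by rewrite -natrX ler_nat ltnW// ltn_expl.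
rewrite mulrA ler_pdivrMr ?exprn_gt0// mul1r (le_trans _ n2)//.
by rewrite mulrC ltW// truncnS_gt.
Qed.

End Pigeonhole.

(** * No separable algebra receives all the algebras *)
Section NoUniversal.
Context {R : realType}.
Local Notation C := (R[i]).

Lemma no_universal_for_davie (B : banachAlgebra R) : separable_space B ->
  ~ forall s, bounded_embeds (@davie R s) B.
Proof.
move=> Bsep emb.
pose f s := projT1 (cid (emb s)).
have fP s : [/\ algebra_hom (f s), injective (f s) & bounded_op (f s)].
  exact: projT2 (cid (emb s)).
have f_lin s : linear (f s) by have [[fl _] _ _] := fP s; exact: fl.
have f_mul s x y : f s (bmul x y) = bmul (f s x) (f s y).
  by have [[_ fM] _ _] := fP s; exact: fM.
have /choice[M MP] s : exists n : nat, forall x, rn (f s x) <= n%:R * rn x.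
  by have [_ _ fb] := fP s; exact: bounded_op_le (f_lin s) fb.
have /choice[m mP] s : exists n : nat, n.+1%:R^-1 <= rn (f s (davie_socle s)).
  have z0 : 0 < rn (f s (davie_socle s)).
    rewrite lt_neqAle rn_ge0 andbT eq_sym; apply/eqP => /rn_eq0 fz.
    have [_ f_inj _] := fP s; apply: (@davie_socle_neq0 R s); apply: f_inj.
    by rewrite fz (raw_lin0 (f_lin s)).
  exists (Num.truncn (rn (f s (davie_socle s)))^-1); rewrite invf_ple ?posrE//.
  by rewrite ltW// truncnS_gt.
have /choice[k kP] (p : nat * nat) : exists k : nat,
    16 * p.1%:R ^+ 2 * p.2.+1%:R * @tail R k <= 1.
  by apply: tail_small; rewrite !mulr_ge0// exprn_ge0.
have /choice[c cP] (p : nat * nat) : exists c : B -> nat, forall x y,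
    c x = c y -> rn (x - y) <= (8 * p.1.+1%:R * p.2.+1%:R : R)^-1.
  by apply: separable_code => //; rewrite invr_gt0 !mulr_gt0.
(* The datum of a sequence: bounds, initial bits, and approximate images of the
   vectors of the level determined by the bounds. *)
pose q s := (M s, m s).
have [s [s' [ss' neq]]] := countable_code_collision (fun s =>
  (q s, [seq s l | l <- iota 0 (k (q s))],
   [seq c (q s) (f s (davie_vec s i)) | i <- words (k (q s))])).
case: ss' => Ms ms; have qs : q s = q s' by rewrite /q Ms ms.
rewrite qs => /eq_in_map bits /eq_in_map codes.
have [n sn nmin] : exists2 n, s n != s' n & forall l, (l < n)%N -> s l = s' l.
  have ex : exists n, s n != s' n.
    apply: contrapT => Nex; apply: neq; apply/funext => l.
    by apply/eqP; apply: contrapT => /negP sl; apply: Nex; exists l.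
  exists (ex_minn ex); first by case: ex_minnP.
  case: ex_minnP => n _ nmin l ln; apply/eqP; apply: contraLR ln => sl.
  by rewrite -leqNgt nmin.
set K := k (q s') in bits codes.
have Kn : (K <= n)%N.
  rewrite leqNgt; apply: contra sn => nK; apply/eqP/bits.
  by rewrite mem_iota.
pose N : R := (M s')%:R; pose D : R := (m s').+1%:R.
have N0 : 0 <= N by []. have D0 : 0 < D by [].
have fs_le x : rn (f s x) <= N * rn x by rewrite /N -Ms MP.
have := rn_trace (f_lin s) (f_lin s') N0 fs_le (MP s') Kn sn
  (fun l Kl => nmin l (proj2 (andP Kl))).
have close i : size i = K ->
    rn (f s (davie_vec s i) - f s' (davie_vec s' i)) <= (8 * (M s').+1%:R * D)^-1.
  by move=> iK; apply: (cP (q s')); apply: codes; rewrite mem_words iK.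
have := rn_socle_image (f_lin s') N0 (MP s') (f_mul s') close.
have := kP (q s'); rewrite -/K /=  -/N -/D => tailK.
have := mP s'; rewrite -/D => Dz zle trle.
have e1 : (8 * (M s').+1%:R * D)^-1 * N <= 8^-1 * D^-1.
  pose N1 : R := (M s').+1%:R; have N10 : 0 < N1 by [].
  have -> : (8 * N1 * D)^-1 * N = N / N1 * (8^-1 * D^-1).
    by field; rewrite !gt_eqF.
  rewrite ler_piMl ?mulr_ge0 ?invr_ge0 ?(ltW D0)//.
  by rewrite ler_pdivrMr// mul1r ler_nat.
have T1 : rn (trace (f s) (f s') K) <= 8^-1 * D^-1.
  rewrite ler_pdivlMr//; rewrite -/K in trle tailK.
  have := ler_wpM2r (ltW D0) trle; lra.
have D1 : 0 < D^-1 by rewrite invr_gt0.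
move: (rn (trace _ _ _)) (rn (f s' _)) (_^-1 * N) zle e1 T1 Dz => u v w.
by move: D^-1 D1 => d; clear; lra.
Qed.

End NoUniversal.

Theorem mainTheorem2 (R : realType) :
  [/\ ~ (exists B : banachAlgebra R, separable_space B /\
         forall A : banachAlgebra R, separable_space A -> bounded_embeds A B),
      ~ (exists B : banachAlgebra R, separable_space B /\
         forall A : banachAlgebra R, separable_space A -> contractive_embeds A B),
      ~ (exists B : banachAlgebra R,
           [/\ separable_space B, commutative_algebra B &
            forall A : banachAlgebra R,
              separable_space A -> commutative_algebra A -> bounded_embeds A B])
    & ~ (exists B : banachAlgebra R,
           [/\ separable_space B, commutative_algebra B &
            forall A : banachAlgebra R,
              separable_space A -> commutative_algebra A -> contractive_embeds A B])].
Proof.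
have contractiveW (A B : banachAlgebra R) :
    contractive_embeds A B -> bounded_embeds A B.
  move=> [f [fh fi fc]]; exists f; split => //.
  by rewrite /bounded_op (le_lt_trans fc)// ltry.
split=> -[B].
- move=> [Bsep univ]; apply: (no_universal_for_davie Bsep) => s.
  exact/univ/davie_separable.
- move=> [Bsep univ]; apply: (no_universal_for_davie Bsep) => s.
  exact/contractiveW/univ/davie_separable.
- move=> [Bsep _ univ]; apply: (no_universal_for_davie Bsep) => s.
  by apply: univ; [exact: davie_separable | exact: davie_commutative].
- move=> [Bsep _ univ]; apply: (no_universal_for_davie Bsep) => s.
  by apply/contractiveW/univ; [exact: davie_separable | exact: davie_commutative].
Qed.
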